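(* Let $(X,T)$ be a Cantor minimal system and let $(p_n)_{n\in\mathbb{N}}$ be a sequence of positive real numbers such that $\lim_{n\to\infty} n/p_n=0$. Then there exists a minimal subshift $(Y,S)$ such that (1) $(Y,S)$ and $(X,T)$ are strong orbit equivalent; and (2) the complexity function $p_Y$ of $(Y,S)$ satisfies $\lim_{n\to\infty} p_Y(n)/p_n=0$.
   Context: $\mathbb{N}$ denotes the non-negative integers. A dynamical system $(X,T)$ is a compact metric space $X$ with a homeomorphism $T:X\to X$. It is minimal if every orbit $\{T^k(x):k\in\mathbb{Z}\}$ is dense in $X$. A Cantor space is a non-empty, metrizable, perfect, totally disconnected compact space; a Cantor minimal system is a minimal system $(X,T)$ with $X$ a Cantor space. An alphabet is a finite non-empty set $\mathcal{A}$; $\mathcal{A}^{\mathbb{Z}}$ carries the product topology of the discrete topologies, and $S((x_i)_{i\in\mathbb{Z}})=(x_{i+1})_{i\in\mathbb{Z}}$ is the shift. A subshift $(Y,S)$ is a closed shift-invariant subset $Y\subseteq\mathcal{A}^{\mathbb{Z}}$ together with the restriction of $S$. The complexity function $p_Y(n)$ is the number of distinct words of length $n$ occurring as blocks of consecutive letters in elements of $Y$. Two minimal dynamical systems $(X_1,T_1)$ and $(X_2,T_2)$ are orbit equivalent if there is a homeomorphism $\phi:X_1\to X_2$ with $\phi(\{T_1^k(x):k\in\mathbb{Z}\})=\{T_2^k\phi(x):k\in\mathbb{Z}\}$ for all $x\in X_1$. This gives maps $n_1,n_2:X_1\to\mathbb{Z}$ (uniquely determined, by minimality, on infinite systems) such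 that for all $x\in X_1$, $\phi(T_1(x))=T_2^{n_1(x)}(\phi(x))$ and $\phi(T_1^{n_2(x)}(x))=T_2(\phi(x))$. The systems are strong orbit equivalent if such a $\phi$ exists for which $n_1$ and $n_2$ each have at most one point of discontinuity. *)

(* Defs.v *)
From mathcomp Require Import all_boot all_order all_algebra.
From mathcomp Require Import all_classical all_reals.
From mathcomp Require Import topology.

Set Implicit Arguments.
Unset Strict Implicit.
Unset Printing Implicit Defensive.

Import Order.TTheory GRing.Theory Num.Theory.

Local Open Scope classical_set_scope.
Local Open Scope ring_scope.

Record homeomorphism (X Y : topologicalType) := Homeomorphism {
  homeo_fun :> X -> Y;
  homeo_inv : Y -> X;
  homeo_funK : cancel homeo_fun homeo_inv;
  homeo_invK : cancel homeo_inv homeo_fun;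
  homeo_fun_continuous : continuous homeo_fun;
  homeo_inv_continuous : continuous homeo_inv
}.

(* The integer power T^k as a map; [Negz n] is the integer -(n+1). *)
Definition iterz (X : topologicalType) (T : homeomorphism X X) (k : int) : X -> X :=
  match k with
  | Posz n => iter n T
  | Negz n => iter n.+1 (homeo_inv T)
  end.

Definition orbitz (X : topologicalType) (T : homeomorphism X X) (x : X) : set X :=
  range (fun k : int => iterz T k x).

Definition minimal_system (X : topologicalType) (T : homeomorphism X X) : Prop :=
  forall x : X, dense (orbitz T x).

(* Metrizability is carried by the type of [X]. The library's [cantor_like] is
   not used: it asks for zero-dimensionality instead of total disconnectedness. *)
Definition is_cantor (R : realType) (X : metricType R) : Prop :=
  [/\ [set: X] !=set0, perfect_set [set: X],
      totally_disconnected [set: X] & compact [set: X]].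

Definition cantor_minimal (R : realType) (X : metricType R)
    (T : homeomorphism X X) : Prop :=
  is_cantor X /\ minimal_system T.

Definition orbit_equivalence (X1 X2 : topologicalType)
    (T1 : homeomorphism X1 X1) (T2 : homeomorphism X2 X2)
    (phi : homeomorphism X1 X2) : Prop :=
  forall x : X1, phi @` orbitz T1 x = orbitz T2 (phi x).

Definition at_most_one_discontinuity (X Y : topologicalType) (f : X -> Y) : Prop :=
  forall x y : X, ~ {for x, continuous f} -> ~ {for y, continuous f} -> x = y.

(* When [T1] and [T2] are minimal on infinite spaces they have no periodic
   points, so [phi] determines [n1] and [n2] and the existential over them is
   not a choice. *)
Definition strong_orbit_equivalent (X1 X2 : topologicalType)
    (T1 : homeomorphism X1 X1) (T2 : homeomorphism X2 X2) : Prop :=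
  exists phi : homeomorphism X1 X2,
    orbit_equivalence T1 T2 phi /\
    exists n1 n2 : X1 -> discrete_topology int,
      [/\ forall x, phi (T1 x) = iterz T2 (n1 x) (phi x),
          forall x, phi (iterz T1 (n2 x) x) = T2 (phi x),
          at_most_one_discontinuity n1 &
          at_most_one_discontinuity n2].

Definition full_shift (A : finType) : topologicalType :=
  prod_topology (fun _ : int => discrete_topology A).

Definition shift_fun (A : finType) (x : full_shift A) : full_shift A :=
  fun i : int => x (i + 1).

Definition shift_inv (A : finType) (x : full_shift A) : full_shift A :=
  fun i : int => x (i - 1).

Lemma shift_funK (A : finType) : cancel (@shift_fun A) (@shift_inv A).
Proof. by move=> x; apply/funext => i; rewrite /shift_fun /shift_inv subrK. Qed.

Lemma shift_invK (A : finType) : cancel (@shift_inv A) (@shift_fun A).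
Proof. by move=> x; apply/funext => i; rewrite /shift_fun /shift_inv addrK. Qed.

Lemma reindex_continuous (A : finType) (s : int -> int) :
  continuous ((fun x i => x (s i)) : full_shift A -> full_shift A).
Proof.
move=> x; apply/cvg_sup; first by apply: fmap_filter; exact: nbhs_filter.
move=> i U [_ [[V oV <-] Vx] VU].
have proj_x := @proj_continuous int (fun=> discrete_topology A) (s i) x V.
apply: (filterS (F := nbhs x)) (proj_x _); first by move=> y; exact: VU.
exact: open_nbhs_nbhs.
Qed.

Definition shift_homeo (A : finType) : homeomorphism (full_shift A) (full_shift A) :=
  Homeomorphism (@shift_funK A) (@shift_invK A)
    (@reindex_continuous A (fun i => i + 1)) (@reindex_continuous A (fun i => i - 1)).

Section restriction.
Variables (X : topologicalType) (T : homeomorphism X X) (Y : set X).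
Hypothesis TY : T @` Y = Y.

Lemma restrict_fun_subproof (y : set_type Y) : T (set_val y) \in Y.
Proof.
apply/mem_set; move: (set_val y) (set_valP y : Y (set_val y)) => x Yx.
suff: (T @` Y) (T x) by rewrite TY.
exact: imageP.
Qed.

Lemma restrict_inv_subproof (y : set_type Y) : homeo_inv T (set_val y) \in Y.
Proof.
apply/mem_set; move: (set_val y) (set_valP y : Y (set_val y)) => x Yx.
have [z Yz <-] : (T @` Y) x by rewrite TY.
by rewrite homeo_funK.
Qed.

Definition restrict_fun (y : set_type Y) : set_type Y :=
  exist _ (T (set_val y)) (restrict_fun_subproof y).

Definition restrict_inv (y : set_type Y) : set_type Y :=
  exist _ (homeo_inv T (set_val y)) (restrict_inv_subproof y).

Lemma restrict_funK : cancel restrict_fun restrict_inv.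
Proof. by move=> y; apply: val_inj; exact: homeo_funK. Qed.

Lemma restrict_invK : cancel restrict_inv restrict_fun.
Proof. by move=> y; apply: val_inj; exact: homeo_invK. Qed.

Lemma restrict_fun_continuous : continuous restrict_fun.
Proof.
apply: continuous_comp_initial => y.
apply: (@continuous_comp _ _ _ set_val T); first exact: initial_continuous.
exact: homeo_fun_continuous.
Qed.

Lemma restrict_inv_continuous : continuous restrict_inv.
Proof.
apply: continuous_comp_initial => y.
apply: (@continuous_comp _ _ _ set_val (homeo_inv T)); first exact: initial_continuous.
exact: homeo_inv_continuous.
Qed.

Definition restrict_homeo : homeomorphism (set_type Y) (set_type Y) :=
  Homeomorphism restrict_funK restrict_invK
    restrict_fun_continuous restrict_inv_continuous.

End restriction.

Record subshift (A : finType) := Subshift {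
  subshift_set :> set (full_shift A);
  subshift_closed : closed subshift_set;
  subshift_invariant : shift_homeo A @` subshift_set = subshift_set
}.

Definition subshift_homeo (A : finType) (Y : subshift A) :
    homeomorphism (set_type Y) (set_type Y) :=
  restrict_homeo (subshift_invariant Y).

Definition occurs (A : finType) (Y : set (full_shift A)) (n : nat)
    (w : n.-tuple A) : Prop :=
  exists2 y : full_shift A, Y y &
    exists i : int, forall j : 'I_n, y (i + (j : nat)%:Z) = tnth w j.

Definition complexity (A : finType) (Y : set (full_shift A)) (n : nat) : nat :=
  #|[pred w : n.-tuple A | `[< occurs Y w >]]|.

(* Main.v *)
Require Import Defs.
From mathcomp Require Import all_boot all_order all_algebra.
From mathcomp Require Import all_classical all_reals.
From mathcomp Require Import topology.
From mathcomp Require Import zify.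

(** Why the theorem is true.

Fix x0 in X.  Clopen sets U shrinking to x0 cut X into columns: orbit segments
between consecutive visits to U, of finitely many types.  Two points lie in a
common column, for some U, exactly when they lie on the same T-orbit and the
passage from T^-1 x0 to x0 is not between them.  Hence, if the points inside
the columns are put in another order, coherently from one U to the next and
with x0 first and T^-1 x0 last, the successor map of the new order extends to
a homeomorphism R with the same orbits as T, and the two cocycles comparing R
with T are locally constant off T^-1 x0.  So R is strong orbit equivalent to T
by the identity map, and the order is ours to choose ([reordered_system]).

The order chosen makes the coding of R by two symbols faithful and of small
complexity.  At stage k the columns are cut into blocks labelled by D_k
letters, equal letters meaning equal lengths.  A block of stage k+1 is a
concatenation of blocks of stage k sorted by letters, 0...01...12..., in which
every letter occurs at least L_k times.
- Faithfulness ([recognizable]): a block of stage k+1 begins exactly where the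
  last letter of stage k is followed by the letter 0, and different letters
  have different block lengths, so the coding determines all the blocks.
- Complexity ([complexity_code]): a window of length n <= L_{k+1} sees at most
  one change of letter of stage k+1.  The word read in it is determined by the
  place of that change and one letter; or, if there is none, by the place of a
  change of letter of stage k and two letters; or, if there is none either, by
  a letter of stage k and a phase.  This gives at most 3 D_k D_{k+1} n words,
  as soon as n exceeds the lengths of the blocks of stage k.

Since p_n / n may grow arbitrarily slowly, L_k has to be chosen after D_k and
D_{k+1}, although longer columns come in more types.  What saves the argument
is [fat_vectors].  Up to order, a long column is a vector in N^d counting the
short columns of each of the d types that it contains; by minimality the
entries of this vector have bounded ratios.  There are 2 d + 1 vectors, with
entries as large as desired, whose positive combinations include all such
vectors with large entries.  Taking one letter of stage k+1 for each of them
gives D_{k+1} = 2 d + 1, known before L_k is chosen ([refine_stage]).  *)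

Set Implicit Arguments.
Unset Strict Implicit.
Unset Printing Implicit Defensive.

Import Order.TTheory GRing.Theory Num.Theory.
Import numFieldTopology.Exports.

(** * Tall vectors that generate all balanced long vectors *)

Lemma sum_three d (F : nat -> nat) :
  \sum_(e < d.*2.+1) F e =
  F 0 + (\sum_(i < d) F i.+1 + \sum_(i < d) F (d + i).+1).
Proof. by rewrite big_ord_recl -addnn big_split_ord. Qed.

Lemma sum_delta d (F : nat -> nat) i : i < d ->
  \sum_(j < d) F j * (i == j) = F i.
Proof.
move=> id; rewrite (bigD1 (Ordinal id)) //= eqxx muln1 big1 ?addn0 // => j.
by rewrite -val_eqE /= eq_sym => /negPf ->; rewrite muln0.
Qed.

(** The vectors are L 1 (for e = 0), then (i+2) L 1 + Q u_i and (i+1) L 1 + (Q+1) u_i for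
i < d, where 1 is the all-ones vector and u_i the i-th unit vector.  The parts Q u_i and
(Q+1) u_i reach any large i-th coordinate since Q and Q+1 are coprime; the multiples of L 1
make all entries large and are compensated by L 1 itself. *)
Definition fat (L Q d e j : nat) : nat :=
  if e is e'.+1 then
    if e' < d then e'.+2 * L + Q * (e' == j)
    else (e' - d).+1 * L + Q.+1 * (e' - d == j)
  else L.

Lemma fat_ge L Q d e j : L <= fat L Q d e j.
Proof. by case: e => [|e] //=; case: ifP => _; nia. Qed.

Section weights.
Variables (L Q d : nat) (h : nat -> nat).
Hypotheses (L2 : 1 < L) (h_gt0 : forall j, j < d -> 0 < h j).
Let n := \sum_(j < d) h j.
Hypothesis QL : d.+2 * (L * n) <= Q.

Let h_le_sum j : j < d -> h j <= n.
Proof. by move=> jd; rewrite /n (bigD1 (Ordinal jd)) //= leq_addr. Qed.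

Let wt e := \sum_(j < d) fat L Q d e j * h j.

Let wt_delta c k i : i < d ->
  \sum_(j < d) (c + k * (i == j)) * h j = c * n + k * h i.
Proof.
move=> id; rewrite (eq_bigr (fun j : 'I_d => c * h j + k * h j * (i == j)));
  last by move=> j _; rewrite mulnDl mulnAC.
by rewrite big_split -big_distrr (sum_delta (fun j => k * h j)).
Qed.

Let quot e := if e is e'.+1 then if e' < d then e'.+2 else (e' - d).+1 else 1.
Let rest e := if e is e'.+1 then if e' < d then 0 else h (e' - d) else 0.

Let rest_lt e : 0 < d -> e < d.*2.+1 -> rest e < L * n.
Proof.
move=> d0; have n0 : 0 < n by apply: leq_trans (h_le_sum d0); exact: h_gt0.
case: e => [|e] /= ed; first by rewrite muln_gt0 n0; lia.
case: ifP => ed'; first by rewrite muln_gt0 n0; lia.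
have : h (e - d) <= n by apply: h_le_sum; lia.
nia.
Qed.

Let wt_mod e : 0 < d -> e < d.*2.+1 -> wt e %% Q = quot e * (L * n) + rest e.
Proof.
move=> d0 ed; have re := rest_lt d0 ed.
have -> : wt e = (if e is e'.+1 then h (if e' < d then e' else e' - d) else 0)
                 * Q + (quot e * (L * n) + rest e).
  case: e ed {re} => [|e] /= ed.
    by rewrite /wt /= -big_distrr /= -/n; lia.
  rewrite /wt /=; case: ifP => ed'.
    by rewrite wt_delta //; nia.
  by rewrite wt_delta; [nia|lia].
rewrite modnMDl modn_small //; apply: leq_trans QL.
suff : quot e <= d.+1 by nia.
by rewrite /quot; case: e ed {re} => [|e] ed //=; case: ifP; lia.
Qed.

(** Modulo Q the weights are L n, (i+2) L n and (i+1) L n + h_i, where n is the sum of the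
h_i.  As 0 < h_i < L n, the quotient and the remainder by L n tell the vectors apart. *)
Lemma fat_weight_inj e e' : e < d.*2.+1 -> e' < d.*2.+1 ->
  \sum_(j < d) fat L Q d e j * h j = \sum_(j < d) fat L Q d e' j * h j -> e = e'.
Proof.
move=> ed ed' /(congr1 (modn^~ Q)).
have [d0|d0] := posnP d; first by move: ed ed'; rewrite d0 /=; lia.
rewrite -!/(wt _) !wt_mod // => E.
have re := rest_lt d0 ed; have re' := rest_lt d0 ed'.
have Er : rest e = rest e'.
  by have := congr1 (modn^~ (L * n)) E; rewrite !modnMDl !modn_small.
have {E} Eq : quot e = quot e' by nia.
case: e e' ed ed' Er Eq {re re'} => [|e] [|e'] //= ed ed'.
- by case: ifP => //; have := h_gt0 (j := e' - d); lia.
- by case: ifP => //; have := h_gt0 (j := e - d); lia.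
case: ifP; case: ifP => // ? ?; have := h_gt0 (j := e' - d);
have := h_gt0 (j := e - d); lia.
Qed.
End weights.

Lemma sum_leq_const d (F : nat -> nat) c :
  (forall i, i < d -> F i <= c) -> \sum_(i < d) F i <= d * c.
Proof.
move=> H; rewrite -[d in X in _ <= X]card_ord -sum_nat_const.
by apply: leq_sum => i _; exact: H.
Qed.

(** Reserve the multiple s L of the all-ones vector, at most half of b, and write each remaining
coordinate as Q x_j + (Q+1) y_j with 1 <= y_j <= Q.  The all-ones parts brought along by these
vectors amount to c L with c < s because Q is large and the coordinates of b are comparable,
and s - c copies of L 1 restore the balance. *)
Lemma fat_decomposition L Q d K (b : nat -> nat) :
  0 < d -> 0 < L -> 0 < K -> 4 * L * K * (d * d.+1 * K) <= Q ->
  (forall j, j < d -> 4 * L * K * (d * d.+1 * Q + 3) + 2 * Q * Q.+2 <= b j) ->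
  (forall i j, i < d -> j < d -> b i <= K * b j) ->
  exists x : nat -> nat, (forall e, 0 < x e) /\
    forall j, j < d -> b j = \sum_(e < d.*2.+1) x e * fat L Q d e j.
Proof.
move=> d0 L0 K0 QK bN bK; set N := 4 * L * K * _ + _ in bN.
have Q0 : 0 < Q by apply: leq_trans QK; rewrite !muln_gt0 /= L0 K0 d0.
(* the entries of b are at least b 0 / K, so this keeps s * L below b j / 2 *)
pose s := b 0 %/ (2 * L * K).
have sLK : 2 * (s * L) * K <= b 0 by rewrite /s; have := leq_divM (b 0) (2 * L * K); nia.
have sL j : j < d -> 2 * (s * L) <= b j.
  by move=> jd; have := bK _ _ d0 jd; nia.
pose B j := b j - s * L.
(* the representative of B j modulo Q in [1, Q], so that y j is positive *)
pose y j := (B j).-1 %% Q + 1.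
pose x j := (B j - Q.+1 * y j) %/ Q.
have yQ j : 0 < y j <= Q by rewrite /y addn1 /= ltn_mod.
have BE j : j < d -> [/\ B j = Q * x j + Q.+1 * y j, 0 < x j & Q * x j <= b j].
  move=> jd; have := sL _ jd; have := bN _ jd => bj sj.
  have Bbig : Q * Q.+2 <= B j by rewrite /B /N in bj *; nia.
  have yle : Q.+1 * y j <= B j by have := yQ j; nia.
  have : Q %| B j - Q.+1 * y j.
    have -> : B j - Q.+1 * y j = Q * ((B j).-1 %/ Q - y j).
      have := divn_eq (B j).-1 Q; have := ltn_pmod (B j).-1 Q0.
      have : 0 < B j by nia.
      rewrite /y; set u := _ %/ _; set v := _ %% _ => B0 vQ E.
      have {E} E : B j = u * Q + v + 1 by lia.
      rewrite mulnBr; nia.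
    by rewrite dvdn_mulr.
  move=> /divnK E; rewrite -/(x j) in E.
  have xb : Q * x j <= b j by rewrite /B in E *; lia.
  split=> //; first by lia.
  rewrite lt0n; apply/eqP => x0; move: E; rewrite x0; have := yQ j; nia.
pose c := \sum_(i < d) i.+2 * x i + \sum_(i < d) i.+1 * y i.
have cs : c < s.
  have c1 : \sum_(i < d) i.+1 * y i <= d * (d * Q).
    by apply: (sum_leq_const (F := fun i => i.+1 * y i)) => i id; have := yQ i; nia.
  have c2 : Q * \sum_(i < d) i.+2 * x i <= d * (d.+1 * (K * b 0)).
    rewrite big_distrr /=.
    apply: (sum_leq_const (F := fun i => Q * (i.+2 * x i))) => i id.
    have [_ _ xb] := BE _ id; have := bK _ _ id d0.
    rewrite mulnCA => bi; apply: leq_mul; [lia|exact: leq_trans bi].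
  have b0 := bN _ d0.
  have sb : b 0 < (s.+1) * (2 * L * K) by apply: ltn_ceil; rewrite !muln_gt0 L0 K0.
  have c3 : 4 * L * K * \sum_(i < d) i.+2 * x i <= b 0.
    have : d * d.+1 * K * (4 * L * K * \sum_(i < d) i.+2 * x i) <= d * d.+1 * K * b 0.
      apply: leq_trans (_ : Q * \sum_(i < d) i.+2 * x i <= _); last first.
        by apply: leq_trans c2 _; rewrite !mulnA.
      rewrite mulnA leq_mul2r; apply/orP; right; lia.
    by rewrite leq_pmul2l // !muln_gt0 d0 K0.
  rewrite /c; set X := \sum_(i < d) i.+2 * _ in c3 *; set Y := \sum_(i < d) _ in c1 *.
  rewrite -(@ltn_pmul2l (4 * L * K)) ?muln_gt0 ?L0 ?K0 //.
  rewrite /N in b0.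
  have Yb : 4 * L * K * Y <= 4 * L * K * (d * d.+1 * Q).
    by rewrite leq_mul2l; apply/orP; right; nia.
  nia.
pose z e := if e is e'.+1 then if e' < d then maxn 1 (x e') else y (e' - d)
            else s - c.
exists z; split=> [[|e]|j jd]; first by rewrite /= subn_gt0.
  rewrite /=.
  by case: ifP => _; [lia|have /andP[] := yQ (e - d)].
rewrite (sum_three _ (fun e => z e * fat L Q d e j)) /=.
under eq_bigr => i _ do rewrite ltn_ord.
under [X in _ + (_ + X)]eq_bigr => i _ do
  rewrite ltnNge leq_addr /= addKn.
have E1 : \sum_(i < d) maxn 1 (x i) * (i.+2 * L + Q * (i == j :> nat)) =
          L * (\sum_(i < d) i.+2 * x i) + Q * x j.
  rewrite (eq_bigr (fun i : 'I_d => L * (i.+2 * x i) + Q * x i * (j == i))).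
    by rewrite big_split -big_distrr (sum_delta (fun j => Q * x j)).
  move=> i _; have [_ xi _] := BE _ (ltn_ord i).
  by have -> : maxn 1 (x i) = x i; [lia|rewrite eq_sym; nia].
have E2 : \sum_(i < d) y i * (i.+1 * L + Q.+1 * (i == j :> nat)) =
          L * (\sum_(i < d) i.+1 * y i) + Q.+1 * y j.
  rewrite (eq_bigr (fun i : 'I_d => L * (i.+1 * y i) + Q.+1 * y i * (j == i))).
    by rewrite big_split -big_distrr (sum_delta (fun j => Q.+1 * y j)).
  by move=> i _; rewrite eq_sym; nia.
rewrite E1 E2; have [BEj _ _] := BE _ jd; have := sL _ jd; rewrite /B in BEj.
rewrite /c in cs *; nia.
Qed.

Lemma fat_vectors d (h : nat -> nat) K L :
  0 < d -> (forall j, j < d -> 0 < h j) ->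
  exists (ev : nat -> nat -> nat) (N : nat),
  [/\ forall e j, L <= ev e j,
      forall e e', e < d.*2.+1 -> e' < d.*2.+1 ->
        \sum_(j < d) ev e j * h j = \sum_(j < d) ev e' j * h j -> e = e' &
      forall b : nat -> nat, (forall j, j < d -> N <= b j) ->
        (forall i j, i < d -> j < d -> b i <= K * b j) ->
        exists x : nat -> nat, (forall e, 0 < x e) /\
          forall j, j < d -> b j = \sum_(e < d.*2.+1) x e * ev e j].
Proof.
move=> d0 h0; pose L' := L.+2; pose K' := K.+1.
pose Q := 4 * L' * K' * (d * d.+1 * K') + d.+2 * (L' * \sum_(j < d) h j).
exists (fat L' Q d), (4 * L' * K' * (d * d.+1 * Q + 3) + 2 * Q * Q.+2).
split=> [e j|e e' ed ed'|b bN bK].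
- by apply: leq_trans (fat_ge _ _ _ _ _); rewrite /L'; lia.
- by apply: (fat_weight_inj (Q := Q)) => //; rewrite leq_addl.
apply: (@fat_decomposition _ _ _ K') => //; first exact: leq_addr.
by move=> i j id jd; apply: leq_trans (bK _ _ id jd) _; rewrite leq_mul2r leqnSn orbT.
Qed.

(** * Blocks of columns and their regrouping by letters *)

Notation block E := (nat * seq E)%type.

Definition spread (E : Type) (bs : seq (block E)) : seq E := flatten (unzip2 bs).

Definition letter (E : Type) (a : nat) : pred (block E) := fun b => b.1 == a.

(** A stable sort by letters, written as the concatenation of the subsequences of each letter
so that the runs of equal letters are visible. *)
Definition regroup (E : Type) (D : nat) (bs : seq (block E)) :=
  flatten [seq seq.filter (letter a) bs | a <- iota 0 D].

Definition relabel (E F : Type) (f : E -> F) (b : block E) : block F :=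
  (b.1, map f b.2).

Lemma spread_cat E (bs bs' : seq (block E)) :
  spread (bs ++ bs') = spread bs ++ spread bs'.
Proof. by rewrite /spread /unzip2 map_cat flatten_cat. Qed.

Lemma spread_flatten E (bss : seq (seq (block E))) :
  spread (flatten bss) = flatten (map (@spread E) bss).
Proof. by elim: bss => //= bs bss IH; rewrite spread_cat IH. Qed.

Lemma spread_relabel E F (f : E -> F) bs :
  spread (map (relabel f) bs) = map f (spread bs).
Proof. by elim: bs => //= b bs IH; rewrite /spread /= map_cat -IH. Qed.

Lemma regroup_relabel E F (f : E -> F) D bs :
  regroup D (map (relabel f) bs) = map (relabel f) (regroup D bs).
Proof.
rewrite /regroup map_flatten -map_comp; congr flatten.
by apply: eq_map => a /=; rewrite filter_map.
Qed.

Lemma regroupS E D (bs : seq (block E)) :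
  regroup D.+1 bs = regroup D bs ++ seq.filter (letter D) bs.
Proof. by rewrite /regroup -addn1 iotaD map_cat flatten_cat /= cats0. Qed.

Lemma regroup_cat_letter E D a (bs : seq (block E)) : a < D ->
  exists bs', regroup D bs = regroup a bs ++ seq.filter (letter a) bs ++ bs'.
Proof.
move=> aD; exists (flatten [seq seq.filter (letter c) bs | c <- iota a.+1 (D - a.+1)]).
rewrite catA -regroupS.
by rewrite /regroup -[in LHS](subnKC aD) iotaD map_cat flatten_cat.
Qed.

Lemma perm_regroup (E : eqType) D (bs : seq (block E)) :
  (forall b, b \in bs -> b.1 < D) -> perm_eq (regroup D bs) bs.
Proof.
move=> bD; have {bD} -> : bs = seq.filter (fun b => b.1 < D) bs.
  by symmetry; apply/all_filterP/allP.
elim: D => [|D IH].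
  by rewrite (@eq_filter _ _ pred0) // filter_pred0.
rewrite regroupS; set bs' := seq.filter _ bs.
have E1 : regroup D bs' = regroup D (seq.filter (fun b => b.1 < D) bs).
  rewrite /regroup; congr flatten; apply/eq_in_map => a; rewrite mem_iota /= => aD.
  rewrite /bs' -!filter_predI; apply: eq_filter => b /=; rewrite /letter.
  by case: eqP => // ->; rewrite aD ltnS ltnW.
rewrite E1; apply: perm_trans (_ : perm_eq (seq.filter (fun b => b.1 < D) bs ++
  seq.filter (letter D) bs') _); first by rewrite perm_cat2r; exact: IH.
have -> : seq.filter (fun b => b.1 < D) bs = seq.filter (fun b => b.1 < D) bs'.
  rewrite -filter_predI; apply: eq_filter => b /=.
  by case: ltnP => // bD; rewrite ltnS ltnW.
have -> : seq.filter (letter D) bs' = seq.filter (predC (fun b => b.1 < D)) bs'.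
  apply: eq_in_filter => b; rewrite mem_filter /letter => /andP[bD _] /=.
  by move: bD; rewrite ltnS -leqNgt eqn_leq => ->.
by rewrite perm_filterC.
Qed.

Lemma perm_spread (E : eqType) (bs bs' : seq (block E)) :
  perm_eq bs bs' -> perm_eq (spread bs) (spread bs').
Proof. by move=> p; apply: perm_flatten; apply: perm_map. Qed.

Lemma regroup_head E D b (bs : seq (block E)) : 0 < D -> b.1 = 0 ->
  exists bs', regroup D (b :: bs) = b :: bs'.
Proof.
move=> D0 b0; have [bs' ->] := regroup_cat_letter (b :: bs) D0.
by rewrite /= /letter b0 /=; eexists.
Qed.

Lemma regroup_last E D b (bs : seq (block E)) : b.1 = D ->
  exists bs', regroup D.+1 (rcons bs b) = rcons bs' b.
Proof.
move=> bD; rewrite regroupS filter_rcons /letter bD eqxx.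
by rewrite -rcons_cat; eexists.
Qed.

Definition run_from (H : nat -> nat) (m : nat -> nat) (a : nat) :=
  \sum_(c < a) m c * H c.

Section sizes.
Variables (E : eqType) (H : nat -> nat) (bs : seq (block E)).
Hypothesis bsH : forall b, b \in bs -> size b.2 = H b.1.

Definition run_start a := run_from H (fun c => count (letter c) bs) a.

Lemma size_spread_sub a bs' : (forall b, b \in bs' -> (b \in bs) && (b.1 == a)) ->
  size (spread bs') = size bs' * H a.
Proof.
elim: bs' => //= b bs' IH Hb; rewrite /spread /= size_cat -/(spread bs') IH; last first.
  by move=> c cb; apply: Hb; rewrite inE cb orbT.
have /andP[bb /eqP ba] := Hb b (mem_head _ _).
by rewrite bsH // ba mulSn.
Qed.

Lemma size_regroup D : size (spread (regroup D bs)) = run_start D.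
Proof.
elim: D => [|D IH]; first by rewrite /run_start /run_from big_ord0.
rewrite regroupS spread_cat size_cat IH /run_start /run_from big_ord_recr /=; congr (_ + _).
rewrite (@size_spread_sub D) ?size_filter // => b.
by rewrite mem_filter /letter => /andP[-> ->].
Qed.

(** Where a block goes when blocks are regrouped: after all blocks with smaller letters and
after c blocks with the same letter. *)
Lemma nth_regroup D b : b \in bs -> b.1 < D ->
  exists2 c, c < count (letter b.1) bs &
    forall x0 i, i < size b.2 ->
      nth x0 (spread (regroup D bs)) (run_start b.1 + c * H b.1 + i) =
      nth x0 b.2 i.
Proof.
move=> bbs bD; set fs := seq.filter (letter b.1) bs.
have bf : b \in fs by rewrite mem_filter /letter eqxx.
exists (index b fs); first by rewrite -size_filter index_mem.
move=> x0 i ib; have [bs' ->] := regroup_cat_letter bs bD.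
rewrite !spread_cat nth_cat size_regroup ifN; last by rewrite -leqNgt -addnA leq_addr.
rewrite -addnA addKn -/fs nth_cat.
have sz1 : size (spread (take (index b fs) fs)) = index b fs * H b.1.
  rewrite (@size_spread_sub b.1) ?size_takel // ?index_size // => c /mem_take.
  by rewrite mem_filter /letter => /andP[-> ->].
have -> : spread fs = spread (take (index b fs) fs) ++ b.2 ++
                      spread (drop (index b fs).+1 fs).
  rewrite -{1}(cat_take_drop (index b fs) fs) spread_cat (drop_nth b) ?index_mem //.
  by rewrite nth_index.
rewrite size_cat sz1 size_cat ifT; last by rewrite ltn_add2l ltn_addr.
rewrite nth_cat sz1 ltnNge leq_addr /= addKn nth_cat ib //.
Qed.
End sizes.

Section body.
Variables (arr : nat -> seq (block nat)) (D : nat) (tau : nat -> nat).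

Definition tagged (s : nat) : seq (block (nat * nat)) :=
  map (relabel (pair s)) (arr (tau s)).

Definition joined (grp : seq nat) := flatten (map tagged grp).

(** The groups are lists of indices of columns, the column s having type tau s.  A position is
kept as a pair of a column and a floor in it, so that replacing s by tau s exhibits the
content of the block independently of where it occurs ([body_map]). *)
Definition body (grp : seq nat) : seq (nat * nat) :=
  spread (regroup D (joined grp)).
End body.

Lemma joined_map arr tau grp :
  map (relabel (fun x => (tau x.1, x.2))) (joined arr tau grp) =
  joined arr id (map tau grp).
Proof.
rewrite /joined map_flatten -!map_comp; congr flatten; apply: eq_map => s /=.
by rewrite -map_comp; apply: eq_map => b; rewrite /relabel /= -map_comp.
Qed.

Lemma body_map arr D tau grp :
  map (fun x => (tau x.1, x.2)) (body arr D tau grp) =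
  body arr D id (map tau grp).
Proof. by rewrite /body -spread_relabel -regroup_relabel joined_map. Qed.

(** * Rearranging a column into words with prescribed contents *)

(** The list arr partitions the floors of a column of height h into blocks.  The conditions on
the first and last blocks keep the bottom floor first and the top floor last in the new order. *)
Record arranged (D : nat) (H : nat -> nat) (h : nat) (arr : seq (block nat)) : Prop :=
  Arranged {
  arr_perm : perm_eq (spread arr) (iota 0 h);
  arr_block : forall b, b \in arr -> b.1 < D /\ size b.2 = H b.1;
  arr_letter : forall a, a < D -> a \in unzip1 arr;
  arr_head : exists l bs, arr = (0, 0 :: l) :: bs;
  arr_last : exists l bs, arr = rcons bs (D.-1, rcons l h.-1) }.

(** Any word with the contents v would do, but it has to start and end with the types of the
first and last columns contained in every column of the next castle. *)
Definition canon (d i0 i1 : nat) (v : nat -> nat) : seq nat :=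
  i0 :: rcons (flatten [seq nseq (v j - (j == i0) - (j == i1)) j | j <- iota 0 d]) i1.

Lemma count_flatten_nseq n (v : nat -> nat) a :
  count_mem a (flatten [seq nseq (v j) j | j <- iota 0 n]) = (a < n) * v a.
Proof.
elim: n => // n IH; rewrite -addn1 iotaD map_cat flatten_cat count_cat IH /= cats0.
rewrite count_nseq /= add0n addn1 ltnS.
by case: (ltngtP a n) => [_|_|->]; rewrite ?mul0n ?addn0 ?mul1n.
Qed.

Lemma count_canon d i0 i1 v a : i0 < d -> i1 < d -> (forall j, 1 < v j) ->
  count_mem a (canon d i0 i1 v) = (a < d) * v a.
Proof.
move=> i0d i1d v2; rewrite /canon /= -cats1 count_cat count_flatten_nseq /= addn0.
have := v2 a; case: (ltnP a d) => ad; rewrite ?mul1n ?mul0n.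
  rewrite (eq_sym a i0) (eq_sym a i1); lia.
by have [-> ->] : (i0 == a) = false /\ (i1 == a) = false by lia.
Qed.

Lemma canon_lt d i0 i1 v j : i0 < d -> i1 < d -> j \in canon d i0 i1 v -> j < d.
Proof.
move=> i0d i1d; rewrite inE mem_rcons inE => /or3P[/eqP->|/eqP->|] //.
by case/flattenP => s /mapP[k]; rewrite mem_iota => /= kd -> /nseqP[-> _].
Qed.

Lemma sumn_map_count d (f : nat -> nat) V : (forall j, j \in V -> j < d) ->
  sumn (map f V) = \sum_(j < d) count_mem (j : nat) V * f j.
Proof.
elim: V => [|a V IH] Vd /=; first by rewrite big1.
rewrite IH; last by move=> j jV; apply: Vd; rewrite inE jV orbT.
have ad : a < d by apply: Vd; rewrite mem_head.
rewrite (eq_bigr (fun j : 'I_d => f j * (a == j) + count_mem (j : nat) V * f j)).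
  by rewrite big_split (sum_delta f).
by move=> j _; rewrite mulnDl mulnC.
Qed.

(** Two words with the same contents and the same end letters differ by a permutation
that fixes both ends; this is how x0 stays first and T^-1 x0 stays last. *)
Lemma perm_with_ends (v0 v1 : nat) V F : perm_eq V F ->
  let W := v0 :: rcons V v1 in
  exists pi, perm_eq (0 :: rcons pi (size V).+1) (iota 0 (size W)) /\
    map (nth 0 W) (0 :: rcons pi (size V).+1) = v0 :: rcons F v1.
Proof.
move=> VF W; have := VF; rewrite perm_sym => /(perm_iotaP 0)[Is IsP FE].
exists (map succn Is); split.
    rewrite /W /= size_rcons perm_cons.
  have -> : iota 1 (size V).+1 = rcons (map succn (iota 0 (size V))) (size V).+1.
    by rewrite -[X in iota _ X]addn1 iotaD cats1 (iotaDl 1 0).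
  rewrite perm_rcons perm_sym perm_rcons perm_cons perm_sym.
  exact: perm_map.
rewrite /W /= map_rcons /= nth_rcons ltnn eqxx FE -map_comp; congr (_ :: rcons _ _).
apply/eq_in_map => s; rewrite (perm_mem IsP) mem_iota /= => sF.
by rewrite nth_rcons sF.
Qed.

Section rearrange.
Variables (d D : nat) (ht H : nat -> nat) (arr : nat -> seq (block nat)).
Hypothesis arrP : forall j, j < d -> arranged D H (ht j) (arr j).

Definition start (V : seq nat) (s : nat) := sumn (map ht (take s V)).

Definition new_block (V : seq nat) (g : nat * seq nat) : block nat :=
  (g.1, [seq start V x.1 + x.2 | x <- body arr D (nth 0 V) g.2]).

Lemma iota_starts (V : seq nat) :
  flatten [seq map (addn (start V s)) (iota 0 (ht (nth 0 V s))) |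
             s <- iota 0 (size V)] = iota 0 (sumn (map ht V)).
Proof.
elim/last_ind: V => // V v IH.
rewrite size_rcons -addn1 iotaD map_cat flatten_cat /= cats0.
rewrite map_rcons sumn_rcons iotaD -IH; congr (_ ++ _).
  congr flatten; apply/eq_in_map => s; rewrite mem_iota /= => sV.
  rewrite nth_rcons sV; congr (map (addn _) _).
  by rewrite /start -cats1 takel_cat // ltnW.
rewrite nth_rcons ltnn eqxx /start add0n -cats1 take_size_cat //.
by rewrite -iotaDl addn0.
Qed.

Lemma spread_joined (tau : nat -> nat) grp :
  spread (joined arr tau grp) =
  flatten [seq map (pair s) (spread (arr (tau s))) | s <- grp].
Proof.
rewrite /joined spread_flatten -map_comp; congr flatten.
by apply: eq_map => s /=; rewrite spread_relabel.
Qed.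

Lemma joined_letter (tau : nat -> nat) grp b :
  (forall s, s \in grp -> tau s < d) -> b \in joined arr tau grp ->
  b.1 < D /\ size b.2 = H b.1.
Proof.
move=> grpd /flattenP[bs /mapP[s sg ->] /mapP[c cs ->]].
by rewrite /= size_map; apply: (arr_block (arrP (grpd s sg))).
Qed.

Lemma perm_body (tau : nat -> nat) grp : (forall s, s \in grp -> tau s < d) ->
  perm_eq (body arr D tau grp) (spread (joined arr tau grp)).
Proof.
move=> grpd; apply: perm_spread; apply: perm_regroup => b bj.
by have [] := joined_letter grpd bj.
Qed.

Lemma perm_flatten_map (S T : eqType) (f g : S -> seq T) s :
  (forall x, x \in s -> perm_eq (f x) (g x)) ->
  perm_eq (flatten (map f s)) (flatten (map g s)).
Proof.
elim: s => //= x s IH fg; apply: perm_cat; first by apply: fg; rewrite mem_head.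
by apply: IH => y ys; apply: fg; rewrite inE ys orbT.
Qed.

Lemma perm_new_blocks V gs : (forall j, j \in V -> j < d) ->
  perm_eq (flatten (unzip2 gs)) (iota 0 (size V)) ->
  perm_eq (spread (map (new_block V) gs)) (iota 0 (sumn (map ht V))).
Proof.
move=> Vd gsP; pose pos (x : nat * nat) := start V x.1 + x.2.
have gsV g s : g \in gs -> s \in g.2 -> s < size V.
  move=> ggs sg; have : s \in iota 0 (size V).
    by rewrite -(perm_mem gsP); apply/flattenP; exists g.2 => //; exact: map_f.
  by rewrite mem_iota.
have tauV s : s < size V -> nth 0 V s < d by move=> sV; exact/Vd/mem_nth.
have -> : spread (map (new_block V) gs) =
    map pos (flatten [seq body arr D (nth 0 V) g.2 | g <- gs]).
  by rewrite map_flatten -map_comp /spread /unzip2 -map_comp.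
apply: perm_trans (_ : perm_eq (map pos (flatten
  [seq spread (joined arr (nth 0 V) g.2) | g <- gs])) _).
  apply: perm_map; apply: perm_flatten_map => g ggs; apply: perm_body => s sg.
  exact/tauV/(gsV g).
have -> : flatten [seq spread (joined arr (nth 0 V) g.2) | g <- gs] =
    spread (joined arr (nth 0 V) (flatten (unzip2 gs))).
  elim: gs {gsP gsV} => //= g gs ->.
  by rewrite /joined map_cat flatten_cat spread_cat.
rewrite spread_joined.
apply: perm_trans (_ : perm_eq (map pos (flatten [seq map (pair s)
  (spread (arr (nth 0 V s))) | s <- iota 0 (size V)])) _).
  by apply: perm_map; apply: perm_flatten; exact: perm_map.
rewrite -iota_starts map_flatten -map_comp; apply: perm_flatten_map => s.
rewrite mem_iota /= => sV; rewrite -map_comp /=.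
by apply: perm_map; apply: arr_perm; apply: arrP; exact: tauV.
Qed.

Lemma body_head (tau : nat -> nat) s grp : 0 < D -> tau s < d ->
  exists r, body arr D tau (s :: grp) = (s, 0) :: r.
Proof.
move=> D0 sd; have [l [bs E]] := arr_head (arrP sd).
rewrite /body /joined /= /tagged E /= /relabel /=.
have [bs' ->] := @regroup_head _ D (0, (s, 0) :: map (pair s) l) (map (relabel (pair s)) bs ++
  flatten [seq map (relabel (pair s0)) (arr (tau s0)) | s0 <- grp]) D0 erefl.
by rewrite /spread /=; eexists.
Qed.

Lemma body_last (tau : nat -> nat) s grp : 0 < D -> tau s < d ->
  exists r, body arr D tau (rcons grp s) = rcons r (s, (ht (tau s)).-1).
Proof.
case: D arrP => // D1 arrP1 _ sd; have [l [bs E]] := arr_last (arrP1 _ sd).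
rewrite /body /joined map_rcons flatten_rcons /tagged E /= map_rcons -rcons_cat.
have [bs' ->] := @regroup_last _ D1 (relabel (pair s) (D1, rcons l (ht (tau s)).-1))
  (flatten [seq map (relabel (pair i)) (arr (tau i)) | i <- grp] ++
   map (relabel (pair s)) bs) erefl.
rewrite -cats1 spread_cat /spread /= cats0 map_rcons -rcons_cat.
by eexists.
Qed.

Lemma grouping (tau : nat -> nat) (cw : nat -> seq nat) E pi :
  map tau pi = flatten (map cw E) ->
  exists gs : seq (nat * seq nat), [/\ unzip1 gs = E, flatten (unzip2 gs) = pi &
    forall g, g \in gs -> map tau g.2 = cw g.1].
Proof.
elim: E pi => [|e E IH] pi /= piE.
  by exists [::]; split => //; case: pi piE.
have [|gs [gs1 gs2 gsP]] := IH (drop (size (cw e)) pi).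
  by rewrite map_drop piE drop_size_cat.
exists ((e, take (size (cw e)) pi) :: gs); split => /=.
- by rewrite gs1.
- by rewrite gs2 cat_take_drop.
- move=> g; rewrite inE => /predU1P[->|/gsP] //=.
  by rewrite map_take piE take_size_cat.
Qed.

(** If the contents of V are a combination of the contents of the canonical words, then V, up to
a permutation fixing both ends, is a concatenation of canonical words; each of them becomes
one new block. *)
Lemma rearrange D' (ev : nat -> nat -> nat) (x : nat -> nat) i0 i1 V V' :
  0 < D -> i0 < d -> i1 < d -> (forall e j, 1 < ev e j) ->
  0 < D' -> (forall e, 0 < x e) ->
  V = i0 :: rcons V' i1 -> (forall j, j \in V -> j < d) ->
  (forall j, j < d -> count_mem j V = \sum_(e < D') x e * ev e j) ->
  let cw e := canon d i0 i1 (ev e) in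
  exists gs : seq (nat * seq nat), [/\
    arranged D' (fun e => size (body arr D id (cw e))) (sumn (map ht V))
             (map (new_block V) gs),
    perm_eq (flatten (unzip2 gs)) (iota 0 (size V)) &
    forall g, g \in gs -> map (nth 0 V) g.2 = cw g.1].
Proof.
case: D' => // D' D0 i0d i1d ev2 _ x0 VE Vd cnt cw.
pose E := flatten [seq nseq (x e) e | e <- iota 0 D'.+1].
have [E1 E1E] : exists E1, E = 0 :: E1.
  rewrite /E /=; case: (x 0) (x0 0) => // n _ /=; by eexists.
have [E2 E2E] : exists E2, E = rcons E2 D'.
  rewrite /E -addn1 iotaD map_cat flatten_cat /= cats0.
  case: (x D') (x0 D') => // n _; exists (flatten [seq nseq (x e) e | e <- iota 0 D'] ++ nseq n D').
  by rewrite rcons_cat -(addn1 n) nseqD cats1.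
pose F := flatten (map cw E).
have [F' FE] : exists F', F = i0 :: rcons F' i1.
  have [X XE] : exists X, F = i0 :: X by rewrite /F E1E /=; eexists.
  have : last i0 F = i1.
    by rewrite /F E2E map_rcons flatten_rcons last_cat /cw /canon /= last_rcons.
  have : 1 < size F by rewrite /F E1E /= size_cat /cw /canon /= size_rcons.
  rewrite XE /=; case/lastP: X {XE} => // F' y _.
  by rewrite last_rcons => ->; exists F'.
have VF : perm_eq V' F'.
  have : perm_eq V F.
    apply/allP => a _ /=; apply/eqP; rewrite /F count_flatten -map_comp.
    rewrite (eq_map (g := fun e => (a < d) * ev e a)); last first.
      by move=> e; apply: count_canon.
    case: (ltnP a d) => ad; last first.
      rewrite (eq_map (g := fun=> 0)); last by move=> e; rewrite mul0n.
      rewrite (count_memPn _).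
        by rewrite sumnE big_map big1.
      by apply/negP => /Vd; rewrite ltnNge ad.
    rewrite cnt // (sumn_map_count (d := D'.+1)).
      by apply: eq_bigr => e _; rewrite mul1n /E count_flatten_nseq ltn_ord mul1n.
    by move=> e /flattenP[s /mapP[e' + ->]] /nseqP[-> _]; rewrite mem_iota.
  by rewrite VE FE perm_cons !perm_rcons perm_sym perm_rcons perm_cons perm_sym.
have [pi [piP piE]] := perm_with_ends i0 i1 VF.
set W := _ :: _ in piP piE; rewrite -VE -FE in piE piP.
have [gs [gs1 gs2 gsP]] := grouping piE.
rewrite -gs2 in piP.
exists gs; split => //; split.
- exact: perm_new_blocks.
- move=> _ /mapP[g ggs ->] /=; split.
    have : g.1 \in E by rewrite -gs1; exact: map_f.
    by move=> /flattenP[s /mapP[e' + ->]] /nseqP[-> _]; rewrite mem_iota.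
  by rewrite size_map -(gsP _ ggs) -body_map size_map.
- move=> e eD; suff : e \in E by rewrite -gs1 /unzip1 -map_comp.
  apply/flattenP; exists (nseq (x e) e); last by rewrite mem_nseq x0 eqxx.
  by apply/mapP; exists e => //; rewrite mem_iota.
- case: gs gs1 gs2 gsP {piP} => [|[e grp] gs] /=; first by rewrite E1E.
  rewrite E1E => -[e0 _] gs2 gsP; subst e.
  have := gsP _ (mem_head _ _) => /=; case: grp gs2 gsP => [|s grp] //= [s0 _] _ [_ _].
  subst s; have [|r] := @body_head (nth 0 V) 0 grp D0; first by rewrite VE.
  by move=> rE; rewrite /new_block /= rE /= /start take0; eexists; eexists.
- case/lastP: gs gs1 gs2 gsP {piP} => [|gs [e grp]]; first by rewrite E1E.
  rewrite /unzip1 /unzip2 !map_rcons E2E => /rcons_inj[_ /= e0]; subst e.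
  rewrite flatten_rcons => gs2 gsP; have := gsP (D', grp).
  rewrite mem_rcons mem_head => /(_ isT) /=.
  case/lastP: grp gs2 gsP => [|grp s] //.
  rewrite /W -rcons_cat -rcons_cons => /rcons_inj[_ sE] _ _.
  have sV : size V = (size V').+2 by rewrite VE /= size_rcons.
  have Vs : nth 0 V s = i1 by rewrite sE VE /= nth_rcons ltnn eqxx.
  have [|r rE] := @body_last (nth 0 V) s grp D0; first by rewrite Vs.
  rewrite /new_block /= rE /= map_rcons Vs /=; eexists; eexists.
  congr (rcons _ (_, rcons _ _)).
  rewrite VE -rcons_cons map_rcons sumn_rcons /start sE -cats1 takel_cat //.
  have h1 : 0 < ht i1.
    have [l [bs El]] := arr_last (arrP i1d).
    have := perm_size (arr_perm (arrP i1d)).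
    by rewrite size_iota El -cats1 spread_cat size_cat /spread /= size_cat size_rcons; lia.
  by rewrite take_oversize //=; lia.
Qed.

End rearrange.

Local Open Scope classical_set_scope.

(** * Locally constant functions on compact zero-dimensional spaces *)

Definition locally_constant (X : topologicalType) (Y : Type) (f : X -> Y) :=
  forall x, \forall y \near x, f y = f x.

Section locally_constant.
Variable X : topologicalType.

Lemma lc_cst (Y : Type) (c : Y) : locally_constant (fun _ : X => c).
Proof. by move=> x; apply: nearW. Qed.

Lemma lc_comp (Y Z : Type) (g : Y -> Z) (f : X -> Y) :
  locally_constant f -> locally_constant (g \o f).
Proof. by move=> lf x; apply: filterS (lf x) => y /= ->. Qed.

Lemma lc_comp2 (Y Y' Z : Type) (g : Y -> Y' -> Z) (f : X -> Y) (f' : X -> Y') :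
  locally_constant f -> locally_constant f' ->
  locally_constant (fun x => g (f x) (f' x)).
Proof. by move=> lf lf' x; apply: filterS2 (lf x) (lf' x) => y -> ->. Qed.

Lemma lc_pull (W : topologicalType) (Y : Type) (phi : W -> X) (f : X -> Y) :
  continuous phi -> locally_constant f -> locally_constant (f \o phi).
Proof. by move=> cphi lf w; exact: (cphi w _ (lf (phi w))). Qed.

Lemma lc_clopen (C : set X) : clopen C -> locally_constant (fun x => `[< C x >]).
Proof.
move=> [oC cC] x; have [Cx|nCx] := pselect (C x).
  have : nbhs x C by apply: open_nbhs_nbhs.
  by apply: filterS => y Cy; rewrite !asboolT.
have : nbhs x (~` C) by apply: open_nbhs_nbhs; split => //; exact: closed_openC.
by apply: filterS => y Cy; rewrite !asboolF.
Qed.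

Lemma lc_open (Y : Type) (f : X -> Y) (P : set Y) : locally_constant f ->
  open [set x | P (f x)].
Proof.
by move=> lf; rewrite openE => x Px; apply: filterS (lf x) => y /= ->.
Qed.

Lemma lc_ex_minn (P : nat -> X -> bool) (exP : forall x, exists i, P i x) :
  (forall i, locally_constant (P i)) ->
  locally_constant (fun x => ex_minn (exP x)).
Proof.
move=> lP x; case: ex_minnP => m Pm minm.
have : \forall y \near x, forall i, (i <= m)%N -> P i y = P i x.
  elim: m {Pm minm} => [|m IH].
    by apply: filterS (lP 0 x) => y E [|//].
  apply: filterS2 IH (lP m.+1 x) => y IH E i.
  by rewrite leq_eqVlt => /predU1P[->|]; [exact: E|exact: IH].
apply: filterS => y Py; case: ex_minnP => k Pk mink.
have km : (k <= m)%N by apply: mink; rewrite Py.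
by apply/eqP; rewrite eqn_leq km minm // -Py.
Qed.

Lemma lc_iter_all (Y : eqType) (n : nat) (f : nat -> X -> Y) :
  (forall i, locally_constant (f i)) ->
  locally_constant (fun x => [seq f i x | i <- iota 0 n]).
Proof.
move=> lf; elim: n => [|n IH]; first exact: lc_cst.
have -> : (fun x => [seq f i x | i <- iota 0 n.+1]) =
          (fun x => rcons [seq f i x | i <- iota 0 n] (f n x)).
  by apply/funext => x; rewrite -addn1 iotaD map_cat cats1.
exact: lc_comp2.
Qed.

Lemma lc_dep (Y Z : Type) (f : X -> Y) (g : Y -> X -> Z) :
  locally_constant f -> (forall c, locally_constant (g c)) ->
  locally_constant (fun x => g (f x) x).
Proof.
by move=> lf lg x; apply: filterS2 (lf x) (lg (f x) x) => y -> ->.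
Qed.

End locally_constant.

Section compactness.
Variable X : topologicalType.
Hypothesis compX : compact [set: X].

Lemma compact_finite_subcover (U : X -> set X) : (forall x, nbhs x (U x)) ->
  exists s : seq X, forall y, exists2 x, x \in s & U x y.
Proof.
move=> Ux; move/compact_near_coveringP: compX.
pose B := fun s0 : seq X => [set s : seq X | {subset s0 <= s}].
have FF : Filter (filter_from setT B).
  apply: filter_from_filter; first by exists [::].
  move=> s t _ _; exists (s ++ t) => // u su.
  by split=> x xs; apply: su; rewrite mem_cat xs ?orbT.
move=> /(_ _ _ (fun s y => exists2 x, x \in s & U x y) FF) [].
  move=> x _; exists (U x, B [:: x]).
    by split => //=; exists [:: x].
  by move=> [y s] [/= Uy xs]; exists x => //; apply: xs; rewrite inE.
by move=> s _ Hs; exists s => y; apply: Hs.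
Qed.

Lemma lc_finite_image (Y : eqType) (f : X -> Y) : locally_constant f ->
  exists s : seq Y, uniq s /\ forall c, (c \in s) <-> exists x, f x = c.
Proof.
move=> lf; have [s sP] := compact_finite_subcover lf.
exists (undup (map f s)); split; first exact: undup_uniq.
move=> c; rewrite mem_undup; split; first by case/mapP => x _ ->; exists x.
by move=> [x <-]; have [y ys ->] := sP x; exact: map_f.
Qed.

(** In a compact Hausdorff space the intersection Q of the clopen sets containing x is connected: if
Q split into closed parts P and N with x in P, normality would give an open U containing P whose
closure misses N, and by compactness some clopen set containing x would miss the boundary of U, so
that its intersection with U would be a clopen set containing x and missing N. *)
Lemma totally_disconnected_zero_dimensional : hausdorff_space X ->
  totally_disconnected [set: X] -> zero_dimensional X.
Proof.
move=> hX tdX x y; apply: contra_neqP => noU.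
pose Q := \bigcap_(D in [set D : set X | clopen D /\ D x]) D.
have Qx : Q x by move=> D [].
have Qy : Q y.
  by move=> D [cD Dx]; apply: contrapT => nDy; apply: noU; exists D.
have cQ : closed Q by apply: closed_bigI => D [[]].
have key (P N : set X) : closed P -> closed N -> P `&` N = set0 ->
    Q = P `|` N -> P x -> N = set0.
  move=> cP cN PN QE Px.
  have [U0 PU0 U0N] : filter_from (set_nbhs P) closure (~` N).
    apply: (compact_normal hX compX) => //.
    apply/set_nbhsP; exists (~` N); split => //; first exact: closed_openC.
    by move=> w Pw Nw; have : (P `&` N) w by []; rewrite PN.
  have /set_nbhsP[U [oU PU UU0]] := PU0.
  have {}U0N : closure U `<=` ~` N by apply: subset_trans U0N; exact: closure_subset.
  pose F := closure U `&` ~` U.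
  have cF : closed F by apply: closedI; [exact: closed_closure|exact: open_closedC].
  have FQ z : F z -> exists D, [/\ clopen D, D x & ~ D z].
    move=> [Uz nUz]; apply: contrapT => noD.
    have : Q z by move=> D [cD Dx]; apply: contrapT => nDz; apply: noD; exists D.
    rewrite QE => -[/PU//|Nz]; exact: (U0N _ Uz).
  have /choice[D DP] : forall z, exists D : set X, F z -> [/\ clopen D, D x & ~ D z].
    move=> z; have [Fz|nFz] := pselect (F z); last by exists setT.
    by have [D HD] := FQ _ Fz; exists D.
  pose W z := if pselect (F z) then ~` D z else ~` F.
  have [z|s sP] := @compact_finite_subcover W.
    rewrite /W; case: pselect => [Fz|nFz]; apply: open_nbhs_nbhs; split => //.
    + by apply: closed_openC; have [[]] := DP _ Fz.
    + by have [] := DP _ Fz.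
    + exact: closed_openC.
  have [E [cE Ex EF]] : exists E, [/\ clopen E, E x & E `&` F = set0].
    have : exists E, [/\ clopen E, E x & forall z, z \in s -> F z -> E `<=` D z].
      elim: s {sP} => [|z s [E [cE Ex IH]]]; first by exists setT; split => //; exact: clopenT.
      have [Fz|nFz] := pselect (F z).
        have [cD Dx _] := DP _ Fz.
        exists (E `&` D z); split => //; first exact: clopenI.
        move=> w; rewrite inE => /predU1P[->|ws] Fw t [Et Dt] //.
        exact: (IH _ ws Fw).
      exists E; split => // w; rewrite inE => /predU1P[->//|ws] Fw.
      exact: IH.
    move=> [E [cE Ex EP]]; exists E; split => //.
    rewrite -subset0 => w [Ew Fw]; have [z zs] := sP w.
    rewrite /W; case: pselect => [Fz|_] //; apply; exact: (EP _ zs Fz).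
  have EUE : E `&` U = E `&` closure U.
    rewrite eqEsubset; split => w [Ew Uw]; split => //; first exact: subset_closure.
    apply: contrapT => nUw; have : (E `&` F) w by [].
    by rewrite EF.
  have QEU : Q `<=` E `&` U.
    move=> w; apply; split; last by split => //; exact: PU.
    case: cE => oE clE; split; first exact: openI.
    by rewrite EUE; apply: closedI => //; exact: closed_closure.
  rewrite -subset0 => w Nw; have /QEU[_ Uw] : Q w by rewrite QE; right.
  exact: (U0N _ (subset_closure Uw)).
have conQ : connected Q.
  move=> B [b Bb] [C oC BC] [D cD BD].
  have cB : closed B by rewrite BD; exact: closedI.
  have cB' : closed (Q `&` ~` C) by apply: closedI => //; exact: open_closedC.
  have BB' : B `&` (Q `&` ~` C) = set0.
    by rewrite -subset0 => w [Bw [_ nCw]]; move: Bw; rewrite BC => -[].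
  have QE : Q = B `|` (Q `&` ~` C).
    rewrite BC -setIUr; rewrite setUv setIT //.
  have [Bx|nBx] := pselect (B x).
    by have := key _ _ cB cB' BB' QE Bx => B'0; rewrite [RHS]QE B'0 setU0.
  have B'x : (Q `&` ~` C) x by move: Qx; rewrite {1}QE => -[].
  rewrite setIC in BB'; rewrite setUC in QE.
  by have B0 := key _ _ cB' cB BB' QE B'x; rewrite B0 in Bb.
have : Q `<=` connected_component setT x by apply: connected_component_max.
by rewrite tdX // => /(_ y Qy) /= ->.
Qed.
End compactness.

(** Finite clopen partitions of mesh tending to zero. *)
Lemma separating_sequence (R : realType) (X : metricType R) :
  compact [set: X] -> totally_disconnected [set: X] ->
  exists q : nat -> X -> nat, (forall n, locally_constant (q n)) /\
    forall x y, (forall n, q n x = q n y) -> x = y.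
Proof.
move=> compX tdX; have hX : hausdorff_space X by exact: metric_hausdorff.
have zdX := totally_disconnected_zero_dimensional compX hX tdX.
have step n : exists q : X -> nat, locally_constant q /\
    forall x y, q x = q y -> ball x (n.+1%:R^-1 + n.+1%:R^-1 : R)%R y.
  have e0 : (0 < n.+1%:R^-1 :> R)%R by rewrite invr_gt0 ltr0n.
  have /choice[C CP] : forall x, exists C : set X,
      [/\ clopen C, C x & C `<=` ball x (n.+1%:R^-1 : R)%R].
    move=> x; have := zero_dimensional_cvg hX zdX compX (nbhsx_ballx x _ e0).
    by case=> C /= [Cx cC] CB; exists C.
  have [x|s sP] := compact_finite_subcover compX (U := C).
    by have [[oC _] Cx _] := CP x; exact: open_nbhs_nbhs.
  exists (fun y => find (fun x => `[< C x y >]) s); split.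
    elim: s {sP} => [|x s IH]; first exact: lc_cst.
    have lx : locally_constant (fun y => `[< C x y >]).
      by apply: lc_clopen; have [] := CP x.
    exact: (lc_comp2 (fun b k => if b then 0%N else k.+1) lx IH).
  move=> y z E.
  have hasy w : has (fun x => `[< C x w >]) s.
    by have [x xs Cx] := sP w; apply/hasP; exists x => //; apply/asboolP.
  have := nth_find y (hasy z); rewrite -E => /asboolP Cz.
  have := nth_find y (hasy y) => /asboolP Cy.
  set x := nth _ _ _ in Cz Cy; have [_ _ CB] := CP x.
  by apply: ball_triangle (CB _ Cz); apply: ball_sym; exact: CB.
have /choice[q qP] := step.
exists q; split=> [n|x y qxy]; first by have [] := qP n.
apply/eqP; rewrite -[_ == _]negbK -mdist_gt0; apply/negP => d0.
have /ltr_add_invr[n] : (0 < mdist x y / 2)%R by rewrite divr_gt0.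
rewrite add0r ltr_pdivlMr // mulr_natr mulr2n => nd.
have [_ /(_ x y (qxy n))] := qP n.
by rewrite ballEmdist /= => /(lt_trans nd); rewrite ltxx.
Qed.

(** * Orbits of minimal homeomorphisms *)

Section iterz.
Variables (X : topologicalType) (T : homeomorphism X X).

Lemma iterz0 x : iterz T 0%R x = x. Proof. by []. Qed.

Lemma iterz_nat n x : iterz T n%:Z%R x = iter n T x. Proof. by []. Qed.

Lemma iterz1 x : iterz T 1%R x = T x. Proof. by []. Qed.

Lemma iterzS k x : iterz T (k + 1)%R x = T (iterz T k x).
Proof.
case: k => [n|[|n]]; first by rewrite -PoszD addn1.
  by rewrite /= homeo_invK.
have -> : (Negz n.+1 + 1)%R = Negz n by lia.
by rewrite /= homeo_invK.
Qed.

Lemma iterzP k x : iterz T (k - 1)%R x = homeo_inv T (iterz T k x).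
Proof. by rewrite -[in RHS](subrK 1%R k) iterzS homeo_funK. Qed.

Lemma iterzD a b x : iterz T (a + b)%R x = iterz T a (iterz T b x).
Proof.
elim/int_rec: a => [|n IH|n IH]; first by rewrite add0r.
  by rewrite -addn1 PoszD -addrA [(1 + b)%R]addrC addrA !iterzS IH.
have -> : (- n.+1%:Z = - n%:Z - 1 :> int)%R by lia.
by rewrite -addrA [(-1 + b)%R]addrC addrA !iterzP IH.
Qed.

Lemma iterzK k : cancel (iterz T k) (iterz T (- k)%R).
Proof. by move=> x; rewrite -iterzD addNr. Qed.

Lemma continuous_iter (f : X -> X) n : continuous f -> continuous (iter n f).
Proof.
move=> cf; elim: n => [|n IH] x; first exact: cvg_id.
by apply: (@continuous_comp _ _ _ (iter n f) f); [exact: IH|exact: cf].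
Qed.

Lemma continuous_iterz k : continuous (iterz T k).
Proof.
by case: k => n; apply: continuous_iter;
  [exact: homeo_fun_continuous|exact: homeo_inv_continuous].
Qed.

Lemma lc_iterz Y (f : X -> Y) k : locally_constant f ->
  locally_constant (fun x => f (iterz T k x)).
Proof. by move=> lf; apply: (lc_pull (@continuous_iterz k) lf). Qed.

Lemma lc_iter Y (f : X -> Y) k : locally_constant f ->
  locally_constant (fun x => f (iter k T x)).
Proof. exact: (lc_iterz k). Qed.

End iterz.

Section minimal.
Variables (X : topologicalType) (T : homeomorphism X X).
Hypotheses (compX : compact [set: X]) (hX : hausdorff_space X).
Hypotheses (perfX : perfect_set [set: X]) (minT : minimal_system T).

(** A periodic orbit is finite, hence closed; being dense it is the whole space, which then has
isolated points. *)
Lemma minimal_aperiodic n x : iter n.+1 T x <> x.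
Proof.
move=> per; pose s := [seq iter i T x | i <- iota 0 n.+1].
have sT y : y \in s -> T y \in s.
  move=> /mapP[i]; rewrite mem_iota /= => ilt ->; rewrite -iterS.
  have [->|ni] := eqVneq i n; first by rewrite per; apply/mapP; exists 0.
  by apply/mapP; exists i.+1 => //; rewrite mem_iota; lia.
have sI y : y \in s -> homeo_inv T y \in s.
  move=> /mapP[[|i]]; rewrite mem_iota /= => ilt ->.
    rewrite -{1}per /= homeo_funK; apply/mapP; exists n => //.
    by rewrite mem_iota; lia.
  by rewrite homeo_funK; apply/mapP; exists i => //; rewrite mem_iota; lia.
have orb k : iterz T k x \in s.
  have xs : x \in s by apply/mapP; exists 0.
  case: k => m; first by elim: m => //= m IH; exact: sT.
  by elim: m => [|m IH]; exact: sI.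
have clo (r : seq X) : closed [set` r].
  by move/accessible_finite_set_closed : (hausdorff_accessible hX); apply; exact: finite_seq.
have all_s y : y \in s.
  apply/negPn/negP => ys.
  have [|z [/= zs [k _ kz]]] := minT x (_ : (~` [set` s]) !=set0) (closed_openC (clo s)).
    by exists y => /=; exact/negP.
  by apply: zs; rewrite -kz /=.
have /perfectTP/(_ x) := perfX; apply.
clearbody s.
have -> : [set x] = ~` [set` [seq y <- s | y != x]].
  apply/seteqP; split => y /=; first by move=> ->; rewrite mem_filter eqxx.
  by move/negP; rewrite mem_filter all_s andbT negbK => /eqP.
exact/closed_openC/clo.
Qed.

Lemma minimal_visit_int (U : set X) : open U -> U !=set0 ->
  exists M, forall x, exists2 k : int, (`|k| <= M)%N & U (iterz T k x).
Proof.
move=> oU U0; have vis x : exists k, U (iterz T k x).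
  by have [y [Uy [k _ kx]]] := minT x U0 oU; exists k; rewrite kx.
have /choice[K KP] := vis.
have [x|s sP] := compact_finite_subcover compX (U := fun x => [set y | U (iterz T (K x) y)]).
  by apply: (@continuous_iterz _ T (K x) x); apply: open_nbhs_nbhs.
exists (\max_(x <- s) `|K x|) => y; have [x xs Ux] := sP y.
exists (K x) => //.
exact: (@leq_bigmax_seq _ s xpredT (fun x => `|K x|%N) x xs isT).
Qed.

Lemma minimal_visit (U : set X) : open U -> U !=set0 ->
  exists R, forall x, exists2 i, i < R & U (iter i T x).
Proof.
move=> oU U0; have [M MP] := minimal_visit_int oU U0.
exists (M + M).+1 => x; have [k kM Uk] := MP (iter M T x).
exists `|(k + M%:Z)%R|; first by lia.
by rewrite -iterz_nat (_ : `|_|%:Z = k + M%:Z)%R ?iterzD //; lia.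
Qed.

Lemma minimal_visit_back (U : set X) : open U -> U !=set0 ->
  forall x, exists i : nat, U (iterz T (- i%:Z)%R x).
Proof.
move=> oU U0 x; have [M MP] := minimal_visit_int oU U0.
have [k kM Uk] := MP (iterz T (- M%:Z)%R x).
exists `|(M%:Z - k)%R|.
by rewrite (_ : - `|_|%:Z = k + - M%:Z)%R ?iterzD //; lia.
Qed.

End minimal.

(** * Castles: Kakutani-Rokhlin partitions *)

(** A partition into towers, encoded by the type and the floor of each point rather than by the
bases of the towers, so that its properties are statements about a point and its image. *)
Record castle (X : Type) := Castle {
  ntypes : nat;
  type_of : X -> nat;
  floor_of : X -> nat;
  height : nat -> nat }.

Record is_castle (X : topologicalType) (F : X -> X) (c : castle X) : Prop := IsCastle {
  lc_type_of : locally_constant (type_of c);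
  lc_floor_of : locally_constant (floor_of c);
  type_of_lt : forall x, type_of c x < ntypes c;
  floor_of_lt : forall x, floor_of c x < height c (type_of c x);
  castle_up : forall x, (floor_of c x).+1 < height c (type_of c x) ->
    type_of c (F x) = type_of c x /\ floor_of c (F x) = (floor_of c x).+1;
  castle_top : forall x, (floor_of c x).+1 = height c (type_of c x) ->
    floor_of c (F x) = 0 }.

Section castle_walk.
Variables (X : topologicalType) (F : X -> X) (c : castle X).
Hypothesis cP : is_castle F c.

Lemma castle_iter x i : floor_of c x + i < height c (type_of c x) ->
  type_of c (iter i F x) = type_of c x /\
  floor_of c (iter i F x) = floor_of c x + i.
Proof.
elim: i => [|i IH]; first by rewrite addn0.
rewrite addnS => hi; have [ti fi] := IH (ltnW hi).
by have [|-> ->] := castle_up cP (x := iter i F x); rewrite ti fi.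
Qed.

Lemma castle_next_base x :
  floor_of c (iter (height c (type_of c x) - floor_of c x) F x) = 0.
Proof.
have := floor_of_lt cP x; set h := height _ _ => xh.
have -> : h - floor_of c x = (h - floor_of c x).-1.+1 by lia.
have [|t f] := @castle_iter x (h - floor_of c x).-1; first by rewrite -/h; lia.
by rewrite iterS; apply: (castle_top cP); rewrite t f -/h; lia.
Qed.

Definition column (h : nat -> nat) (i : nat) : seq (nat * nat) :=
  [seq (i, z) | z <- iota 0 (h i)].

Lemma castle_itinerary n y : floor_of c y = 0 -> floor_of c (iter n F y) = 0 ->
  exists2 V, forall v, v \in V -> exists x, type_of c x = v &
    [seq (type_of c (iter i F y), floor_of c (iter i F y)) | i <- iota 0 n]
    = flatten (map (column (height c)) V).
Proof.
elim/ltn_ind: n y => n IH y y0 yn.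
have [->|n0] := posnP n; first by exists [::].
set h := height c (type_of c y).
have hn : h <= n.
  rewrite leqNgt; apply/negP => nh.
  by have [|_] := @castle_iter y n; rewrite y0 ?add0n // yn; lia.
have h0 : 0 < h by have := floor_of_lt cP y; rewrite -/h; lia.
have yh : floor_of c (iter h F y) = 0.
  by have := castle_next_base y; rewrite y0 subn0.
have [||V VR VE] := IH (n - h) _ (iter h F y) yh; first by lia.
  by rewrite -iterD subnK.
exists (type_of c y :: V).
  by move=> v; rewrite inE => /predU1P[->|/VR//]; exists y.
rewrite -{1}(subnKC hn) iotaD map_cat /=; congr (_ ++ _).
  rewrite /column -/h; apply/eq_in_map => i; rewrite mem_iota /= => ih.
  by have [|-> ->] := @castle_iter y i; rewrite y0.
rewrite -VE add0n -[X in iota X _]addn0 iotaDl -map_comp; apply: eq_map => i /=.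
by rewrite addnC iterD.
Qed.
End castle_walk.

Section castle_exists.
Variables (X : topologicalType) (T : homeomorphism X X).
Hypotheses (compX : compact [set: X]) (minT : minimal_system T).
Variables (U : set X) (g : X -> nat).
Hypotheses (clU : clopen U) (U0 : U !=set0) (lg : locally_constant g).

Let oU : open U. Proof. by case: clU. Qed.

Let ex_back x : exists i, `[< U (iterz T (- i%:Z)%R x) >].
Proof.
have [i Ui] := minimal_visit_back compX minT oU U0 x.
by exists i; apply/asboolP.
Qed.

Let ex_fwd x : exists i, `[< U (iter i.+1 T x) >].
Proof.
have [R RP] := minimal_visit compX minT oU U0.
by have [i _ Ui] := RP (T x); exists i; apply/asboolP; rewrite iterSr.
Qed.

Let back x := ex_minn (ex_back x).
Let fwd x := ex_minn (ex_fwd x).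

Let lU : locally_constant (fun x => `[< U x >]). Proof. exact: lc_clopen. Qed.

Let lc_back : locally_constant back.
Proof.
apply: (lc_ex_minn (P := fun i x => `[< U (iterz T (- i%:Z)%R x) >])) => i.
exact: (lc_iterz T _ lU).
Qed.

Let lc_fwd : locally_constant fwd.
Proof.
apply: (lc_ex_minn (P := fun i x => `[< U (iter i.+1 T x) >])) => i.
exact: (lc_iter T i.+1 lU).
Qed.

Let back0 x : back x = 0 <-> U x.
Proof.
rewrite /back; case: ex_minnP => m /asboolP Um min_m; split=> [m0|Ux].
  by move: Um; rewrite m0.
by apply/eqP; rewrite -leqn0; apply: min_m; apply/asboolP.
Qed.

Let back_step x : ~ U (T x) -> back (T x) = (back x).+1.
Proof.
have stepE i : iterz T (- i.+1%:Z)%R (T x) = iterz T (- i%:Z)%R x.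
  by rewrite -iterz1 -iterzD; congr iterz; lia.
rewrite /back; case: ex_minnP => m /asboolP Um min_m.
case: ex_minnP => k /asboolP Uk min_k nU.
case: m Um min_m => [//|m]; rewrite stepE => Um min_m.
apply/eqP; rewrite eqn_leq !ltnS min_k ?andbT; last exact/asboolP.
by apply: (min_m k.+1); apply/asboolP; rewrite stepE.
Qed.

Let fwd0 x : U (T x) -> fwd x = 0.
Proof.
rewrite /fwd; case: ex_minnP => m /asboolP Um min_m Ux.
by apply/eqP; rewrite -leqn0; apply: min_m; apply/asboolP.
Qed.

Let fwd_step x : ~ U (T x) -> fwd x = (fwd (T x)).+1.
Proof.
rewrite /fwd; case: ex_minnP => m /asboolP Um min_m.
case: ex_minnP => k /asboolP Uk min_k nU.
case: m Um min_m => [//|m] Um min_m.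
apply/eqP; rewrite eqn_leq min_m ?ltnS ?min_k //; apply/asboolP.
  by rewrite -iterSr.
by rewrite iterSr.
Qed.

Let name_at (bf : nat * nat) x :=
  [seq g (iterz T (- bf.1%:Z + i%:Z)%R x) | i <- iota 0 (bf.1 + bf.2).+1].
Let name x := name_at (back x, fwd x) x.

Let lc_name : locally_constant name.
Proof.
apply: (lc_dep (g := name_at)); first exact: lc_comp2.
by move=> bf; apply: lc_iter_all => i; exact: lc_iterz.
Qed.

Let name_step x : ~ U (T x) -> name (T x) = name x.
Proof.
move=> nU; rewrite /name /name_at /= back_step // [in RHS]fwd_step //.
rewrite addSnnS; congr (_ :: _); [congr g|apply: eq_map => i; congr g];
by rewrite -iterz1 -iterzD; congr iterz; lia.
Qed.

(** The floor of x is the time since the last visit to U.  The type of its column is the name of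
the column, that is, the list of values of g along it, so that type and floor determine g. *)
Lemma castle_exists : exists (c : castle X) (nm : nat -> seq nat), [/\
  is_castle T c,
  forall x, floor_of c x = 0 <-> U x,
  forall i, i < ntypes c -> exists x, type_of c x = i,
  forall i, height c i = size (nm i) &
  forall x, g x = nth 0 (nm (type_of c x)) (floor_of c x)].
Proof.
have [s [us sP]] := lc_finite_image compX lc_name.
pose nm i := nth [::] s i.
pose c := Castle (size s) (fun x => index (name x) s) back (fun i => size (nm i)).
have ns x : name x \in s by apply/sP; exists x.
have nmE x : nm (index (name x) s) = name x by rewrite /nm nth_index.
have heightE x : size (nm (index (name x) s)) = (back x + fwd x).+1.
  by rewrite nmE size_map size_iota.
have topP x : back x + 1 = (back x + fwd x).+1 -> U (T x).
  move=> top; apply: contrapT => nU.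
  by move: (fwd_step nU) top; lia.
exists c, nm; split => //.
- split => //=.
  + exact: (lc_comp (fun n => index n s) lc_name).
  + by move=> x; rewrite index_mem.
  + by move=> x; rewrite heightE ltnS leq_addr.
  + move=> x; rewrite heightE => up.
    have nU : ~ U (T x) by move=> /fwd0 f0; move: up; rewrite f0; lia.
    by rewrite name_step // back_step.
  + by move=> x; rewrite heightE => top; apply/back0/topP; lia.
- move=> i /= si; have /sP[x xi] : nth [::] s i \in s by exact: mem_nth.
  by exists x; rewrite xi index_uniq.
- move=> x /=; rewrite nmE /name /name_at.
  have bx : back x < ((back x, fwd x).1 + (back x, fwd x).2).+1.
    by rewrite ltnS leq_addr.
  by rewrite (nth_map 0) ?size_iota // nth_iota // add0n addNr.
Qed.
End castle_exists.

(** * Stages: castles with reordered columns *)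

Section castle_move.
Variables (X : topologicalType) (T : homeomorphism X X) (c : castle X).
Hypothesis cP : is_castle T c.

Lemma castle_back x i : i <= floor_of c x ->
  type_of c (iterz T (- i%:Z)%R x) = type_of c x /\
  floor_of c (iterz T (- i%:Z)%R x) = floor_of c x - i.
Proof.
elim: i => [|i IH] ix; first by rewrite subn0.
have [ti fi] := IH (ltnW ix).
set y := iterz T (- i.+1%:Z)%R x.
have Ty : iterz T (- i%:Z)%R x = T y.
  by rewrite /y -iterzS; congr iterz; lia.
have lt_y := floor_of_lt cP y.
case: (ltngtP (floor_of c y).+1 (height c (type_of c y))) => [up|over|top]; last 1 first.
- by have := castle_top cP top; rewrite -Ty fi; lia.
- by have [ty fy] := castle_up cP up; rewrite -Ty ti fi in ty fy; split => //; lia.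
- by move: over; rewrite ltnNge lt_y.
Qed.

Lemma castle_move x z : z < height c (type_of c x) ->
  let y := iterz T (z%:Z - (floor_of c x)%:Z)%R x in
  type_of c y = type_of c x /\ floor_of c y = z.
Proof.
move=> zh y; have [t0 f0] := castle_back (leqnn (floor_of c x)).
rewrite subnn in f0.
have yE : y = iter z T (iterz T (- (floor_of c x)%:Z)%R x).
  by rewrite -iterz_nat -iterzD.
have [|ty fy] := @castle_iter _ _ _ cP (iterz T (- (floor_of c x)%:Z)%R x) z.
  by rewrite f0 t0.
by rewrite yE ty fy t0 f0.
Qed.
End castle_move.

(** A letter a stands for blocks of length len a, and arr i is the partition into blocks of the
columns of type i.  The new order runs along each block; the order of the blocks inside a
column is immaterial, except for the first and the last one. *)
Record stage (X : Type) := Stage {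
  stage_castle :> castle X;
  nletters : nat;
  len : nat -> nat;
  arr : nat -> seq (block nat) }.

Record is_stage (X : topologicalType) (T : homeomorphism X X) (x0 : X) (s : stage X)
    : Prop := IsStage {
  stage_is_castle : is_castle T s;
  stage_onto : forall i, i < ntypes s -> exists x, type_of s x = i;
  stage_base : floor_of s x0 = 0;
  stage_letters : 1 < nletters s;
  stage_arranged : forall i, i < ntypes s ->
    arranged (nletters s) (len s) (height s i) (arr s i) }.

Definition find_block (bs : seq (block nat)) (z : nat) : block nat :=
  nth (0, [::]) bs (find (fun b => z \in b.2) bs).

Lemma find_block_in bs z : z \in spread bs ->
  find_block bs z \in bs /\ z \in (find_block bs z).2.
Proof.
move=> zbs; have hz : has (fun b : block nat => z \in b.2) bs.
  by case/flattenP: zbs => l /mapP[b bb ->] zb; apply/hasP; exists b.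
by split; [apply: mem_nth; rewrite -has_find|exact: (nth_find (0, [::]) hz)].
Qed.

Lemma find_block_eq bs z b : uniq (spread bs) -> b \in bs -> z \in b.2 ->
  find_block bs z = b.
Proof.
rewrite /find_block; elim: bs => //= b' bs IH.
rewrite /spread /= cat_uniq => /and3P[_ /hasPn dis ubs].
rewrite inE => /predU1P[->|bbs] zb; first by rewrite zb.
rewrite ifN; first exact: IH.
apply: dis; apply/flattenP; exists b.2 => //; exact: map_f.
Qed.

Section stage_facts.
Variables (X : topologicalType) (T : homeomorphism X X) (x0 : X) (s : stage X).
Hypothesis sP : is_stage T x0 s.

Definition block_at (x : X) := find_block (arr s (type_of s x)) (floor_of s x).
Definition letter_of (x : X) := (block_at x).1.
Definition pos_of (x : X) := index (floor_of s x) (block_at x).2.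
(** The power of T leading from x to the i-th point of its block. *)
Definition jump (x : X) (i : nat) : int :=
  ((nth 0%N (block_at x).2 i)%:Z - (floor_of s x)%:Z)%R.

Let cP := stage_is_castle sP.

Lemma arranged_at x : arranged (nletters s) (len s) (height s (type_of s x))
  (arr s (type_of s x)).
Proof. exact/(stage_arranged sP)/(type_of_lt cP). Qed.

Lemma arr_uniq i : i < ntypes s -> uniq (spread (arr s i)).
Proof.
move=> /(stage_arranged sP)/arr_perm/perm_uniq ->; exact: iota_uniq.
Qed.

Lemma block_at_in x : block_at x \in arr s (type_of s x) /\
  floor_of s x \in (block_at x).2.
Proof.
apply: find_block_in; rewrite (perm_mem (arr_perm (arranged_at x))) mem_iota.
exact: (floor_of_lt cP).
Qed.

Lemma block_at_eq x b : b \in arr s (type_of s x) -> floor_of s x \in b.2 ->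
  block_at x = b.
Proof. by apply: find_block_eq; exact/arr_uniq/(type_of_lt cP). Qed.

Lemma size_block_at x : size (block_at x).2 = len s (letter_of x).
Proof. by have [/(arr_block (arranged_at x))[]] := block_at_in x. Qed.

Lemma block_at_uniq x : uniq (block_at x).2.
Proof.
have [bx _] := block_at_in x.
have := arr_uniq (type_of_lt cP x).
move: bx; elim: (arr s _) => //= b bs IH.
rewrite inE /spread /= cat_uniq => /predU1P[->|xb] /and3P[] //.
by move=> _ _ ubs; apply: IH.
Qed.

Lemma letter_of_lt x : letter_of x < nletters s.
Proof. by have [/(arr_block (arranged_at x))[]] := block_at_in x. Qed.

Lemma pos_of_lt x : pos_of x < len s (letter_of x).
Proof. by rewrite -size_block_at index_mem; have [] := block_at_in x. Qed.

Lemma floor_pos x : nth 0 (block_at x).2 (pos_of x) = floor_of s x.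
Proof. by apply: nth_index; have [] := block_at_in x. Qed.

Lemma jump_pos x : jump x (pos_of x) = 0%R.
Proof. by rewrite /jump floor_pos subrr. Qed.

Lemma jump_block x i : i < len s (letter_of x) ->
  let y := iterz T (jump x i) x in
  [/\ type_of s y = type_of s x, floor_of s y = nth 0 (block_at x).2 i,
      block_at y = block_at x & pos_of y = i].
Proof.
move=> ilt y; have [bx _] := block_at_in x.
have zb : nth 0 (block_at x).2 i \in (block_at x).2.
  by apply: mem_nth; rewrite size_block_at.
have zh : nth 0 (block_at x).2 i < height s (type_of s x).
  have : nth 0 (block_at x).2 i \in spread (arr s (type_of s x)).
    by apply/flattenP; exists (block_at x).2 => //; exact: map_f.
  by rewrite (perm_mem (arr_perm (arranged_at x))) mem_iota.
have [ty fy] := castle_move cP zh; rewrite -/(jump x i) -/y in ty fy.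
have by_ : block_at y = block_at x.
  by apply: block_at_eq; rewrite ?ty ?fy.
split=> //; rewrite /pos_of by_ fy index_uniq ?size_block_at //.
exact: block_at_uniq.
Qed.

(** The points of a block do not depend on the point from which they are reached. *)
Lemma jump_jump x i j : i < len s (letter_of x) ->
  iterz T (jump (iterz T (jump x i) x) j) (iterz T (jump x i) x) =
  iterz T (jump x j) x.
Proof.
move=> ilt; have [_ fy by_ _] := jump_block ilt.
set y := iterz T _ x in fy by_ *.
have -> : jump y j = (jump x j - jump x i)%R.
  by rewrite /jump by_ fy; lia.
by rewrite /y -iterzD subrK.
Qed.

Lemma lc_block_at : locally_constant block_at.
Proof.
exact: (lc_comp2 (fun i z => find_block (arr s i) z) (lc_type_of cP) (lc_floor_of cP)).
Qed.

Lemma lc_letter_of : locally_constant letter_of.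
Proof. exact: (lc_comp (fun b : block nat => b.1) lc_block_at). Qed.

Lemma lc_pos_of : locally_constant pos_of.
Proof.
exact: (lc_comp2 (fun (b : block nat) z => index z b.2) lc_block_at (lc_floor_of cP)).
Qed.

Lemma lc_jump i : locally_constant (jump^~ i).
Proof.
exact: (lc_comp2 (fun (b : block nat) (z : nat) => ((nth 0%N b.2 i)%:Z - z%:Z)%R)
  lc_block_at (lc_floor_of cP)).
Qed.

End stage_facts.

(** * Finer castles *)

Lemma count_visits (P : pred nat) R n : (forall i, exists2 k, k < R & P (i + k)) ->
  n %/ R <= count P (iota 0 n).
Proof.
move=> vis; have key q : q <= count P (iota 0 (q * R)).
  elim: q => // q IH; rewrite mulSnr iotaD count_cat -addn1 leq_add // add0n.
  have [k kR Pk] := vis (q * R); rewrite -has_count; apply/hasP.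
  by exists (q * R + k) => //; rewrite mem_iota leq_addr ltn_add2l.
apply: leq_trans (key (n %/ R)) _.
by rewrite -{2}(subnKC (leq_divM n R)) iotaD count_cat leq_addr.
Qed.

Lemma nth_columns h V z : z < sumn (map h V) ->
  exists2 k, k < size V & exists2 w, w < h (nth 0 V k) &
    z = start h V k + w /\
    nth (0, 0) (flatten (map (column h) V)) z = (nth 0 V k, w).
Proof.
elim: V z => //= v V IH z zlt; rewrite nth_cat size_map size_iota.
case: ltnP => [zv|vz].
  exists 0 => //; exists z => //; split; first by rewrite /start take0.
  by rewrite (nth_map 0) ?size_iota // nth_iota.
have [|k kV [w wk [zE nE]]] := IH (z - h v); first by lia.
exists k.+1 => //; exists w => //; split; last by rewrite nE.
by rewrite /start /= -addnA -/(start h V k) -zE subnKC.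
Qed.

Lemma size_columns h V : size (flatten (map (column h) V)) = sumn (map h V).
Proof.
rewrite size_flatten /shape -map_comp; congr sumn; apply: eq_map => v /=.
by rewrite size_map size_iota.
Qed.

Lemma count_columns h V j : (forall i, i \in V -> 0 < h i) ->
  count_mem (j, 0) (flatten (map (column h) V)) = count_mem j V.
Proof.
elim: V => //= v V IH hV; rewrite count_cat IH; last first.
  by move=> i iV; apply: hV; rewrite inE iV orbT.
congr (_ + _); have := hV v (mem_head _ _); rewrite /column.
case: (h v) => // n _ /=; rewrite (@count_map _ _ (pair v)).
rewrite (@eq_in_count _ _ pred0) ?count_pred0 ?addn0.
  by rewrite xpair_eqE eqxx andbT.
by move=> z; rewrite mem_iota /= xpair_eqE; case: z => //= z; rewrite andbF.
Qed.

Lemma column_head h v : 0 < h v -> exists s, column h v = (v, 0) :: s.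
Proof. by rewrite /column; case: (h v) => // n _; eexists. Qed.

Lemma column_last h v : 0 < h v -> exists s, column h v = rcons s (v, (h v).-1).
Proof.
rewrite /column; case: (h v) => // n _; rewrite -addn1 iotaD map_cat cats1 addn1.
by eexists.
Qed.

(** A column of type u of c' is the concatenation of the columns of c whose types are
listed in V u. *)
Record coarser (X : Type) (c c' : castle X) (i0 i1 : nat) (V : nat -> seq nat) : Prop :=
  Coarser {
  coarser_at : forall x, exists2 k, k < size (V (type_of c' x)) &
    nth 0 (V (type_of c' x)) k = type_of c x /\
    floor_of c' x = start (height c) (V (type_of c' x)) k + floor_of c x;
  coarser_height : forall u, u < ntypes c' -> height c' u = sumn (map (height c) (V u));
  coarser_lt : forall u j, u < ntypes c' -> j \in V u -> j < ntypes c;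
  coarser_ends : forall u, u < ntypes c' -> exists V', V u = i0 :: rcons V' i1 }.

Section castle_refine.
Variables (X : topologicalType) (T : homeomorphism X X).
Hypotheses (compX : compact [set: X]) (hX : hausdorff_space X).
Hypotheses (perfX : perfect_set [set: X]) (minT : minimal_system T).
Variables (q : nat -> X -> nat).
Hypotheses (lq : forall n, locally_constant (q n)).
Hypothesis sepq : forall x y, (forall n, q n x = q n y) -> x = y.
Variables (x0 : X) (c : castle X).
Hypotheses (cP : is_castle T c) (c_x0 : floor_of c x0 = 0).
Hypothesis c_onto : forall i, i < ntypes c -> exists x, type_of c x = i.

Let Tm1x0 := homeo_inv T x0.

Lemma base_visit j : j < ntypes c -> exists R, forall x,
  exists2 i, i < R & type_of c (iter i T x) = j /\ floor_of c (iter i T x) = 0.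
Proof.
move=> /c_onto[y yj].
pose U := [set x | (type_of c x, floor_of c x) = (j, 0)].
have oU : open U.
  apply: (lc_open (f := fun x => (type_of c x, floor_of c x)) (fun p => p = (j, 0))).
  exact: (lc_comp2 pair (lc_type_of cP) (lc_floor_of cP)).
have [t0 f0] := castle_back cP (leqnn (floor_of c y)).
have [|R RP] := minimal_visit compX minT oU.
  by exists (iterz T (- (floor_of c y)%:Z)%R y); rewrite /U /= t0 f0 subnn yj.
by exists R => x; have [i iR [Ut Uf]] := RP x; exists i.
Qed.

(** By minimality and compactness the bases of all types are visited within a common time R.
A column of height h therefore contains at least h / R columns of each type, which bounds
the ratios of the numbers of columns of the various types. *)
Lemma base_visits : exists R, 0 < R /\ forall j x, j < ntypes c ->
  exists2 i, i < R & type_of c (iter i T x) = j /\ floor_of c (iter i T x) = 0.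
Proof.
have /choice[R RP] : forall j, exists R, j < ntypes c -> forall x,
    exists2 i, i < R & type_of c (iter i T x) = j /\ floor_of c (iter i T x) = 0.
  move=> j; have [jc|jc] := ltnP j (ntypes c); last by exists 0.
  by have [R RP] := base_visit jc; exists R.
exists (\max_(j < ntypes c) R j).+1; split => // j x jc.
have [i iR Hi] := RP j jc x; exists i => //; apply: leq_trans iR _.
exact: leqW (leq_bigmax (Ordinal jc)).
Qed.

(** Returns to U within time M are excluded by finitely many q_m distinguishing x0 from its
images; these exist as x0 is not periodic. *)
Lemma fine_neighborhood n M : exists U : set X, [/\ clopen U, U x0,
  forall x, U x -> [/\ floor_of c x = 0, type_of c x = type_of c x0,
    type_of c (homeo_inv T x) = type_of c Tm1x0 & q n x = q n x0] &
  forall x i, 0 < i <= M -> U x -> ~ U (iter i T x)].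
Proof.
have /choice[m mP] : forall i, exists m, 0 < i -> q m (iter i T x0) <> q m x0.
  case=> [|i]; first by exists 0.
  apply: contrapT => /forallNP Hm; apply: (minimal_aperiodic hX perfX minT (n := i) (x := x0)).
  apply: sepq => m; have /not_implyP[_ /contrapT //] := Hm m.
(* U is the set of the points at which all these data are the same as at x0 *)
pose F x := ((floor_of c x, type_of c x, (type_of c (homeo_inv T x), q n x)),
  [seq (q (m i) x, q (m i) (iter i T x)) | i <- iota 0 M.+1]).
have lF : locally_constant F.
  apply: (lc_comp2 pair).
    apply: (lc_comp2 pair).
      exact: (lc_comp2 pair (lc_floor_of cP) (lc_type_of cP)).
    by apply: (lc_comp2 pair) => //; exact: (lc_iterz T (-1)%R (lc_type_of cP)).
  apply: lc_iter_all => i; apply: (lc_comp2 pair) => //.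
  exact: (lc_iter T i (lq (m i))).
have FM x i : i <= M -> F x = F x0 -> q (m i) x = q (m i) x0 /\
    q (m i) (iter i T x) = q (m i) (iter i T x0).
  move=> iM [_ _ _ _ E0 E1 Es].
  have : [seq (q (m i) x, q (m i) (iter i T x)) | i <- iota 0 M.+1] =
         [seq (q (m i) x0, q (m i) (iter i T x0)) | i <- iota 0 M.+1].
    by rewrite /= E0 Es.
  by move/eq_in_map/(_ i); rewrite mem_iota ltnS => /(_ iM)[-> ->].
exists [set x | F x = F x0]; split => //.
- split; first exact: (lc_open (f := F) (fun p => p = F x0)).
  rewrite -[X in closed X]setCK; apply: open_closedC.
  exact: (lc_open (f := F) (fun p => p <> F x0)).
- by move=> x /= [-> -> -> -> _ _ _].
- move=> x i /andP[i0 iM] /= Fx Fix.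
  have [qx qix] := FM _ _ iM Fx; have [qix0 _] := FM _ _ iM Fix.
  by apply: (mP i i0); rewrite -qix.
Qed.

(** The bound K on the ratios does not depend on how tall the columns of c' are required to
be; this is what allows the tall vectors to be chosen before c'. *)
Lemma castle_refine : exists K, forall n N, exists (c' : castle X) (V : nat -> seq nat),
  [/\ is_castle T c' /\ (forall i, i < ntypes c' -> exists x, type_of c' x = i),
      forall x, floor_of c' x = 0 -> q n x = q n x0,
      floor_of c' x0 = 0 /\ (forall x y, type_of c' x = type_of c' y ->
        floor_of c' x = floor_of c' y -> q n x = q n y),
      coarser c c' (type_of c x0) (type_of c Tm1x0) V &
      forall u, u < ntypes c' ->
        (forall j, j < ntypes c -> N <= count_mem j (V u)) /\
        (forall i j, i < ntypes c -> j < ntypes c ->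
           count_mem i (V u) <= K * count_mem j (V u))].
Proof.
have [R [R0 RP]] := base_visits.
exists (2 * R) => n N; pose M := R * N.+2.
have [U [clU Ux0 UP UM]] := fine_neighborhood n M.
pose g x := pickle (type_of c x, floor_of c x, q n x).
have lg : locally_constant g.
  apply: (lc_comp pickle (f := fun x => (type_of c x, floor_of c x, q n x))).
  apply: (lc_comp2 pair) => //.
  exact: (lc_comp2 pair (lc_type_of cP) (lc_floor_of cP)).
have [c' [nm [cP' c'U c'onto nmsz gE]]] :=
  castle_exists compX minT clU (ex_intro _ x0 Ux0) lg.
pose dec k := odflt (0, 0, 0) (unpickle k) : nat * nat * nat.
have decE x : dec (nth 0 (nm (type_of c' x)) (floor_of c' x)) =
    (type_of c x, floor_of c x, q n x).
  by rewrite -gE /dec /g pickleK.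
have /choice[y yP] : forall u, exists y, u < ntypes c' ->
    type_of c' y = u /\ floor_of c' y = 0.
  move=> u; have [uc|uc] := ltnP u (ntypes c'); last by exists x0.
  have [x xu] := c'onto u uc; have [t0 f0] := castle_back cP' (leqnn (floor_of c' x)).
  by exists (iterz T (- (floor_of c' x)%:Z)%R x) => _; rewrite t0 f0 subnn xu.
have yU u : u < ntypes c' -> U (y u) by move=> /yP[_ /c'U].
have yU' u : u < ntypes c' -> U (iter (height c' u) T (y u)).
  move=> uc; have [tu fu] := yP u uc; apply/c'U.
  by have := castle_next_base cP' (y u); rewrite tu fu subn0.
have h0 u : u < ntypes c' -> 0 < height c' u.
  by move=> uc; have [tu fu] := yP u uc; have := floor_of_lt cP' (y u); rewrite tu; lia.
have hM u : u < ntypes c' -> M < height c' u.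
  move=> uc; rewrite ltnNge; apply/negP => hM.
  by apply: (UM (y u) (height c' u)); rewrite ?h0 //; [exact: yU|exact: yU'].
pose L u := [seq (type_of c (iter i T (y u)), floor_of c (iter i T (y u))) |
  i <- iota 0 (height c' u)].
have /choice[V VP] : forall u, exists V, u < ntypes c' ->
    (forall v, v \in V -> exists x, type_of c x = v) /\
    L u = flatten (map (column (height c)) V).
  move=> u; have [uc|uc] := ltnP u (ntypes c'); last by exists [::].
  have [||V VR VE] := @castle_itinerary _ _ _ cP (height c' u) (y u).
  - by have [] := UP _ (yU u uc).
  - by have [] := UP _ (yU' u uc).
  by exists V.
have Lnth u i : u < ntypes c' -> i < height c' u -> nth (0, 0) (L u) i =
    (type_of c (iter i T (y u)), floor_of c (iter i T (y u))).
  by move=> uc ih; rewrite (nth_map 0) ?size_iota // nth_iota.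
have Vsz u : u < ntypes c' -> height c' u = sumn (map (height c) (V u)).
  by move=> uc; have [_ VE] := VP _ uc; rewrite -size_columns -VE size_map size_iota.
have LE x : nth (0, 0) (L (type_of c' x)) (floor_of c' x) = (type_of c x, floor_of c x).
  have uc := type_of_lt cP' x; have xh := floor_of_lt cP' x.
  have [ty fy] := yP _ uc.
  rewrite Lnth //; have [|t f] := @castle_iter _ _ _ cP' (y (type_of c' x)) (floor_of c' x).
    by rewrite ty fy.
  have := decE (iter (floor_of c' x) T (y (type_of c' x))).
  by rewrite t f ty fy add0n decE => -[-> ->].
have VL u j : u < ntypes c' -> j \in V u -> j < ntypes c /\ 0 < height c j.
  move=> uc jV; have [/(_ j jV)[x <-] _] := VP _ uc.
  by have := floor_of_lt cP x; have := type_of_lt cP x; lia.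
have Vcnt u j : u < ntypes c' -> j < ntypes c -> height c' u %/ R <= count_mem j (V u).
  move=> uc jc; have [VR VE] := VP _ uc.
  rewrite -(count_columns (h := height c)); last by move=> i /(VL _ _ uc)[].
  rewrite -VE count_map; apply: count_visits => i.
  have [k kR [tk fk]] := RP j (iter i T (y u)) jc; exists k => //=.
  by rewrite addnC iterD tk fk.
have Vmax u j : u < ntypes c' -> count_mem j (V u) <= height c' u.
  move=> uc; have [VR VE] := VP _ uc.
  rewrite -(count_columns (h := height c)); last by move=> i /(VL _ _ uc)[].
  by apply: leq_trans (count_size _ _) _; rewrite -VE size_map size_iota.
exists c', V; split => //.
- by move=> x /c'U/UP[].
- split; first exact/c'U.
  move=> x x' tE fE; have := decE x; have := decE x'.
  by rewrite tE fE => -> [].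
- split => //.
  + move=> x; have uc := type_of_lt cP' x; have xh := floor_of_lt cP' x.
    rewrite Vsz // in xh; have [k kV [w wk [zE nE]]] := nth_columns xh.
    have [VR VE] := VP _ uc; rewrite -VE LE in nE; case: nE => tE fE.
    by exists k => //; rewrite -tE fE.
  + by move=> u j uc /(VL _ _ uc)[].
  + move=> u uc; have [VR VE] := VP _ uc.
    have hR : 1 < height c' u %/ R.
      apply: leq_trans (_ : N.+2 <= _) => //; rewrite leq_divRL // mulnC.
      exact/ltnW/hM.
    have /(leq_trans hR) : height c' u %/ R <= size (V u).
      by apply: leq_trans (Vcnt u 0 uc _) (count_size _ _); have := type_of_lt cP x0; lia.
    have [_ tb _ _] := UP _ (yU u uc).
    have [_ _ tt _] := UP _ (yU' u uc).
    have := Lnth u 0 uc (h0 u uc); have := Lnth u (height c' u).-1 uc.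
    have hv j : j \in V u -> 0 < height c j by move=> /(VL _ _ uc)[].
    rewrite ltn_predL h0 // => /(_ isT).
    have -> : iter (height c' u).-1 T (y u) = homeo_inv T (iter (height c' u) T (y u)).
      by rewrite -{2}(prednK (h0 u uc)) iterS homeo_funK.
    rewrite tt tb (_ : (height c' u).-1 = (size (L u)).-1); last by rewrite size_map size_iota.
    rewrite nth_last VE; case: (V u) hv => [|v V1] //= hv.
    case/lastP: V1 hv => // V1 v1 hv.
    have /column_head[s0 ->] := hv v (mem_head _ _).
    have /column_last[s1 E1] : 0 < height c v1.
      by apply: hv; rewrite inE mem_rcons mem_head orbT.
    rewrite map_rcons flatten_rcons E1 !last_cat last_rcons => -[<- _] [<- _] _.
    by exists V1.
- move=> u uc; split.
    move=> j jc; apply: leq_trans (Vcnt u j uc jc).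
    by rewrite leq_divRL // mulnC; apply: leq_trans (ltnW (hM u uc)); rewrite leq_mul2l; lia.
  move=> i j ic jc; apply: leq_trans (Vmax u i uc) _.
  apply: leq_trans (_ : 2 * R * (height c' u %/ R) <= _).
    have := ltn_ceil (height c' u) R0; have : 1 <= height c' u %/ R.
      rewrite leq_divRL // mul1n; apply: leq_trans (ltnW (hM u uc)).
      by rewrite /M leq_pmulr.
    nia.
  by rewrite leq_mul2l Vcnt // orbT.
Qed.
End castle_refine.

(** * Refining a stage *)

(** How the blocks of s' are made of blocks of s, seen from a point: m e a is the number of
blocks of letter a in a block of letter e.  The field [refines_same] says that a column of s is
contained in a single block of s'. *)
Record refines (X : topologicalType) (T : homeomorphism X X) (s s' : stage X)
    (L : nat) (m : nat -> nat -> nat) : Prop := Refines {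
  refines_mult : forall e a, e < nletters s' -> a < nletters s -> L <= m e a;
  refines_len : forall e, e < nletters s' -> len s' e = run_from (len s) (m e) (nletters s);
  refines_pos : forall x, exists2 c, c < m (letter_of s' x) (letter_of s x) &
    pos_of s' x = run_from (len s) (m (letter_of s' x)) (letter_of s x) +
                  c * len s (letter_of s x) + pos_of s x;
  refines_jump : forall x, (pos_of s x).+1 < len s (letter_of s x) ->
    jump s' x (pos_of s' x).+1 = jump s x (pos_of s x).+1;
  refines_bottom : forall x, pos_of s' x = 0 -> floor_of s x = 0;
  refines_top : forall x, (pos_of s' x).+1 = len s' (letter_of s' x) ->
    (floor_of s x).+1 = height s (type_of s x);
  refines_same : forall x, (floor_of s x).+1 < height s (type_of s x) ->
    [/\ type_of s' (T x) = type_of s' x, floor_of s' (T x) = (floor_of s' x).+1 &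
        block_at s' (T x) = block_at s' x];
  refines_sep : forall x y, letter_of s' x = letter_of s' y ->
    pos_of s' x = pos_of s' y ->
    type_of s x = type_of s y /\ floor_of s x = floor_of s y;
  refines_len_inj : forall e e', e < nletters s' -> e' < nletters s' ->
    len s' e = len s' e' -> e = e' }.

Lemma count_letter_relabel (E F : Type) (f : E -> F) a (bs : seq (block E)) :
  count (letter a) (map (relabel f) bs) = count (letter a) bs.
Proof. by rewrite count_map; apply: eq_count. Qed.

Section refine.
Variables (X : topologicalType) (T : homeomorphism X X) (x0 : X).
Variables (s : stage X) (c' : castle X) (V : nat -> seq nat) (i0 i1 : nat).
Hypotheses (sP : is_stage T x0 s) (cP' : is_castle T c') (c'_x0 : floor_of c' x0 = 0).
Hypothesis c'_onto : forall i, i < ntypes c' -> exists x, type_of c' x = i.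
Hypothesis coV : coarser s c' i0 i1 V.
Hypotheses (i0d : i0 < ntypes s) (i1d : i1 < ntypes s).
Variables (ev : nat -> nat -> nat) (L : nat) (gs : nat -> seq (nat * seq nat)).
Hypotheses (ev2 : forall e j, 1 < ev e j) (evL : forall e j, L <= ev e j).
Let D' := (ntypes s).*2.+1.
Hypothesis ev_inj : forall e e', e < D' -> e' < D' ->
  \sum_(j < ntypes s) ev e j * height s j = \sum_(j < ntypes s) ev e' j * height s j ->
  e = e'.
Let cw e := canon (ntypes s) i0 i1 (ev e).
Let CJ e := joined (arr s) id (cw e).
Let D := nletters s.
Let len' e := size (body (arr s) D id (cw e)).
Let arr' u := map (new_block D (height s) (arr s) (V u)) (gs u).
Hypothesis arr'P : forall u, u < ntypes c' ->
  arranged D' len' (sumn (map (height s) (V u))) (arr' u).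
Hypothesis gs_perm : forall u, u < ntypes c' ->
  perm_eq (flatten (unzip2 (gs u))) (iota 0 (size (V u))).
Hypothesis gs_canon : forall u g, u < ntypes c' -> g \in gs u ->
  map (nth 0 (V u)) g.2 = cw g.1.

Let s' := Stage c' D' len' arr'.
Let m e a := count (letter a) (CJ e).

Let D0 : 0 < D. Proof. by have := stage_letters sP; rewrite -/D; lia. Qed.

Let s'P : is_stage T x0 s'.
Proof.
split => //=; first by rewrite /D' ltnS double_gt0; lia.
by move=> u uc; rewrite (coarser_height coV uc); exact: arr'P.
Qed.

Let cw_lt e j : j \in cw e -> j < ntypes s.
Proof. exact: canon_lt. Qed.

Let joined_block e b : b \in CJ e -> b.1 < D /\ size b.2 = len s b.1.
Proof. by apply: (joined_letter (stage_arranged sP)) => j; exact: cw_lt. Qed.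

Let len'E e : len' e = run_from (len s) (m e) D.
Proof.
by rewrite /len' /body (@size_regroup _ (len s)) // => b /joined_block[].
Qed.

Let len'_weight e : len' e = \sum_(j < ntypes s) ev e j * height s j.
Proof.
rewrite /len' (perm_size (perm_body (stage_arranged sP) _)); last exact: cw_lt.
rewrite spread_joined size_flatten /shape -map_comp.
rewrite (eq_in_map _ (height s) _).1; last first.
  move=> j /cw_lt jd /=.
  by rewrite size_map (perm_size (arr_perm (stage_arranged sP jd))) size_iota.
rewrite (sumn_map_count (d := ntypes s)); last exact: cw_lt.
by apply: eq_bigr => j _; rewrite count_canon // ltn_ord mul1n.
Qed.

Let mult_ge e a : a < D -> L <= m e a.
Proof.
move=> aD; apply: leq_trans (evL e i0) _.
have <- : count_mem i0 (cw e) = ev e i0 by rewrite count_canon // i0d mul1n.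
apply: leq_trans (count_size _ _) _.
rewrite /m /CJ /joined count_flatten -map_comp -sum1_size sumnE big_map big_seq.
rewrite [X in _ <= X]big_seq; apply: leq_sum => j /cw_lt jd /=.
rewrite /tagged count_letter_relabel -has_count.
have /mapP[b bb ->] := arr_letter (stage_arranged sP jd) aD.
by apply/hasP; exists b => //; rewrite /letter.
Qed.

Let group_of u k : u < ntypes c' -> k < size (V u) ->
  exists2 g, g \in gs u & k \in g.2.
Proof.
move=> uc kV; have : k \in flatten (unzip2 (gs u)).
  by rewrite (perm_mem (gs_perm uc)) mem_iota.
by case/flattenP => _ /mapP[g gg ->] kg; exists g.
Qed.

Let group_lt u g k : u < ntypes c' -> g \in gs u -> k \in g.2 ->
  nth 0 (V u) k < ntypes s.
Proof.
by move=> uc gg kg; apply: (@cw_lt g.1); rewrite -(gs_canon uc gg); exact: map_f.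
Qed.

Let find_new u g k w : u < ntypes c' -> g \in gs u -> k \in g.2 ->
  w < height s (nth 0 (V u) k) ->
  find_block (arr' u) (start (height s) (V u) k + w) =
    new_block D (height s) (arr s) (V u) g.
Proof.
move=> uc gg kg wh; apply: find_block_eq.
- by rewrite (perm_uniq (arr_perm (arr'P uc))) iota_uniq.
- exact: map_f.
- apply/mapP; exists (k, w) => //.
  rewrite (perm_mem (perm_body (stage_arranged sP) _)); last first.
    by move=> k'; exact: group_lt.
  rewrite spread_joined; apply/flattenP.
  exists (map (pair k) (spread (arr s (nth 0 (V u) k)))); first by apply/mapP; exists k.
  apply: map_f; rewrite (perm_mem (arr_perm (stage_arranged sP _))) ?mem_iota //.
  exact: group_lt gg kg.
Qed.

(** The witnesses are the group g of columns that the new block of x comes from, the column k of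
this group that contains x, and the number c of blocks with the letter of the old block of x
that precede it in the new block. *)
Let locate x : exists g k c, let u := type_of c' x in
  let bd := body (arr s) D (nth 0 (V u)) g.2 in
  [/\ g \in gs u /\ k \in g.2, nth 0 (V u) k = type_of s x,
      floor_of c' x = start (height s) (V u) k + floor_of s x,
      block_at s' x = new_block D (height s) (arr s) (V u) g &
      c < m g.1 (letter_of s x) /\ forall i, i < len s (letter_of s x) ->
        nth (0, 0) bd (run_from (len s) (m g.1) (letter_of s x) +
                   c * len s (letter_of s x) + i) = (k, nth 0 (block_at s x).2 i)].
Proof.
have uc := type_of_lt cP' x; have [k kV [tk fk]] := coarser_at coV x.
have [g gg kg] := group_of uc kV.
have wh : floor_of s x < height s (nth 0 (V (type_of c' x)) k).
  by rewrite tk; exact: (floor_of_lt (stage_is_castle sP)).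
set u := type_of c' x in uc kV tk fk gg kg wh *.
pose AJ := joined (arr s) (nth 0 (V u)) g.2.
pose b := relabel (pair k) (block_at s x).
have AJC a : count (letter a) AJ = m g.1 a.
  by rewrite /m /CJ -(gs_canon uc gg) -joined_map count_letter_relabel.
have AJlen b' : b' \in AJ -> b'.1 < D /\ size b'.2 = len s b'.1.
  by apply: (joined_letter (stage_arranged sP)) => k'; exact: group_lt.
have bAJ : b \in AJ.
  apply/flattenP; exists (tagged (arr s) (nth 0 (V u)) k); first exact: map_f.
  by apply: map_f; rewrite tk; have [] := block_at_in sP x.
have [||c cm cE] := @nth_regroup _ (len s) AJ _ D b bAJ.
- by move=> b' /AJlen[].
- by have [] := AJlen _ bAJ.
have runE a : run_start (len s) AJ a = run_from (len s) (m g.1) a.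
  by apply: eq_bigr => i _; rewrite AJC.
exists g, k, c; split => //.
  by rewrite /block_at /= -/u fk; exact: find_new.
split; first by move: cm; rewrite AJC.
move=> i ilt; have iB : i < size (block_at s x).2 by rewrite (size_block_at sP).
move: (cE (0, 0) i); rewrite size_map runE => /(_ iB) ->.
by rewrite (nth_map 0).
Qed.

Let letter'E x g u : block_at s' x = new_block D (height s) (arr s) (V u) g ->
  letter_of s' x = g.1.
Proof. by rewrite /letter_of => ->. Qed.

Let pos'E x g k c : let u := type_of c' x in
  let bd := body (arr s) D (nth 0 (V u)) g.2 in
  let P := run_from (len s) (m g.1) (letter_of s x) +
           c * len s (letter_of s x) + pos_of s x in
  floor_of c' x = start (height s) (V u) k + floor_of s x ->
  block_at s' x = new_block D (height s) (arr s) (V u) g ->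
  nth (0, 0) bd P = (k, floor_of s x) -> P < size bd ->
  pos_of s' x = P.
Proof.
move=> u bd P fk bE nE Psz; rewrite /pos_of bE.
have -> : floor_of s' x = nth 0 (new_block D (height s) (arr s) (V u) g).2 P.
  by rewrite /= (nth_map (0, 0)) // nE.
rewrite index_uniq ?size_map //= -[map _ _]/((new_block D (height s) (arr s) (V u) g).2) -bE.
exact: (block_at_uniq s'P).
Qed.

Let body_size g u : u < ntypes c' -> g \in gs u ->
  size (body (arr s) D (nth 0 (V u)) g.2) = len' g.1.
Proof. by move=> uc gg; rewrite /len' -(gs_canon uc gg) -body_map size_map. Qed.

Let run_le f a b : a <= b -> run_from (len s) f a <= run_from (len s) f b.
Proof.
move=> ab; rewrite /run_from -(subnKC ab) big_split_ord /=; exact: leq_addr.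
Qed.

Let locate_pos x g k c : let u := type_of c' x in
  let bd := body (arr s) D (nth 0 (V u)) g.2 in
  [/\ g \in gs u /\ k \in g.2, nth 0 (V u) k = type_of s x,
      floor_of c' x = start (height s) (V u) k + floor_of s x,
      block_at s' x = new_block D (height s) (arr s) (V u) g &
      c < m g.1 (letter_of s x) /\ forall i, i < len s (letter_of s x) ->
        nth (0, 0) bd (run_from (len s) (m g.1) (letter_of s x) +
                   c * len s (letter_of s x) + i) = (k, nth 0 (block_at s x).2 i)] ->
  [/\ pos_of s' x = run_from (len s) (m g.1) (letter_of s x) +
           c * len s (letter_of s x) + pos_of s x,
      nth (0, 0) bd (pos_of s' x) = (k, floor_of s x) &
      forall i, i < len s (letter_of s x) -> run_from (len s) (m g.1) (letter_of s x) +
           c * len s (letter_of s x) + i < size bd].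
Proof.
move=> u bd [[gg kg] tk fk bE [cm cE]].
have lt i : i < len s (letter_of s x) -> run_from (len s) (m g.1) (letter_of s x) +
           c * len s (letter_of s x) + i < size bd.
  move=> ilt; rewrite body_size ?(type_of_lt cP') // len'E.
  apply: leq_trans (run_le _ (letter_of_lt sP x)).
  rewrite /run_from big_ord_recr /= -addnA ltn_add2l.
  apply: (@leq_trans (c.+1 * len s (letter_of s x))); first by rewrite mulSn addnC ltn_add2r.
  by rewrite leq_mul2r cm orbT.
have nE := cE _ (pos_of_lt sP x); rewrite (floor_pos sP) in nE.
have posE := pos'E fk bE nE (lt _ (pos_of_lt sP x)).
by split => //; rewrite posE.
Qed.

Lemma refines_new_stage : refines T s s' L m.
Proof.
split.
- by move=> e a _; exact: mult_ge.
- by move=> e _; exact: len'E.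
- move=> x; have [g [k [c H]]] := locate x; have [posE _ _] := locate_pos H.
  have [_ _ _ /letter'E lE [cm _]] := H.
  by exists c; rewrite lE.
- move=> x up; have [g [k [c H]]] := locate x; have [posE _ lt] := locate_pos H.
  have [_ _ fk bE [cm cE]] := H.
  have := lt _ up; rewrite addnS -posE => Plt.
  have := cE _ up; rewrite addnS -posE => nE.
  rewrite /jump bE /= (nth_map (0, 0)) // nE fk /=; lia.
- move=> x p0; have [g [k [c H]]] := locate x; have [posE nE _] := locate_pos H.
  have [[gg kg] _ _ _ _] := H; have uc := type_of_lt cP' x.
  move: nE (gs_canon uc gg) (fun k => @group_lt _ g k uc gg); rewrite p0.
  case: g.2 => //= k0 grp nE _ grp_lt.
  have [|r rE] := @body_head _ _ _ _ _ (stage_arranged sP) (nth 0 (V (type_of c' x))) k0 grp D0.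
    by apply: grp_lt; exact: mem_head.
  by move: nE; rewrite rE => -[].
- move=> x top; have [g [k [c H]]] := locate x; have [posE nE _] := locate_pos H.
  have [[gg kg] tk _ bE _] := H; have uc := type_of_lt cP' x.
  have := body_size uc gg.
  move: top; rewrite (letter'E bE) /= => <-.
  move: nE (gs_canon uc gg) (fun k => @group_lt _ g k uc gg).
  case/lastP: g.2 => //= grp k1 nE _ grp_lt.
  have k1d : nth 0 (V (type_of c' x)) k1 < ntypes s.
    by apply: grp_lt; rewrite mem_rcons mem_head.
  have [r rE] := @body_last _ _ _ _ _ (stage_arranged sP) _ k1 grp D0 k1d.
  rewrite rE size_rcons => -[rP]; move: nE; rewrite rE nth_rcons -rP ltnn eqxx.
  case=> k1E <-; rewrite prednK; first by rewrite -tk k1E.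
  have [l [bs El]] := arr_last (stage_arranged sP k1d).
  have := perm_size (arr_perm (stage_arranged sP k1d)).
  by rewrite size_iota El -cats1 spread_cat size_cat /spread /= size_cat size_rcons; lia.
- move=> x up; have [g [k [c [[gg kg] tk fk bE _]]]] := locate x.
  have uc := type_of_lt cP' x.
  have kV : k < size (V (type_of c' x)).
    have : k \in iota 0 (size (V (type_of c' x))).
      by rewrite -(perm_mem (gs_perm uc)); apply/flattenP; exists g.2 => //; exact: map_f.
    by rewrite mem_iota.
  have up' : (floor_of c' x).+1 < height c' (type_of c' x).
    rewrite (coarser_height coV uc) fk -[V _ in X in _ < X](cat_take_drop k.+1).
    rewrite map_cat sumn_cat (take_nth 0) // map_rcons sumn_rcons -/(start _ _ k) tk.
    by rewrite -addnS -addnA ltn_add2l; apply: leq_trans up _; exact: leq_addr.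
  have [tT fT] := castle_up cP' up'; split => //.
  rewrite bE /block_at /= tT fT fk -addnS; apply: find_new => //.
  by rewrite tk.
- move=> x y lE pE; have [g [k [c H]]] := locate x; have [_ nE lt] := locate_pos H.
  have [g' [k' [c2 H']]] := locate y; have [_ nE' lt'] := locate_pos H'.
  have [[gg _] tk _ bE _] := H; have [[gg' _] tk' _ bE' _] := H'.
  have uc := type_of_lt cP' x; have uc' := type_of_lt cP' y.
  have Psz : pos_of s' x < size (body (arr s) D (nth 0 (V (type_of c' x))) g.2).
    by rewrite (body_size uc gg) -(letter'E bE); exact: (pos_of_lt s'P).
  have Psz' : pos_of s' y < size (body (arr s) D (nth 0 (V (type_of c' y))) g'.2).
    by rewrite (body_size uc' gg') -(letter'E bE'); exact: (pos_of_lt s'P).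
  have gE : g.1 = g'.1 by rewrite -(letter'E bE) lE (letter'E bE').
  have K : nth (0, 0) (body (arr s) D id (cw g.1)) (pos_of s' x) =
           (type_of s x, floor_of s x).
    by rewrite -(gs_canon uc gg) -body_map (nth_map (0, 0)) // nE /= tk.
  have K' : nth (0, 0) (body (arr s) D id (cw g'.1)) (pos_of s' y) =
           (type_of s y, floor_of s y).
    by rewrite -(gs_canon uc' gg') -body_map (nth_map (0, 0)) // nE' /= tk'.
  by move: K; rewrite gE pE K' => -[-> ->].
- move=> e e' eD eD' /=; rewrite !len'_weight; exact: ev_inj.
Qed.

Lemma is_stage_new_stage : is_stage T x0 s'. Proof. exact: s'P. Qed.

End refine.

(** * The sequence of stages *)

Lemma dependent_choice_nat (S : Type) (P : nat -> S -> Prop) (R : nat -> S -> S -> Prop) :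
  (exists s, P 0 s) -> (forall k s, P k s -> exists2 s', P k.+1 s' & R k s s') ->
  exists f : nat -> S, forall k, P k (f k) /\ R k (f k) (f k.+1).
Proof.
move=> [s0 P0] step.
have /choice[F FP] : forall ks : nat * S, exists s', P ks.1 ks.2 ->
    P ks.1.+1 s' /\ R ks.1 ks.2 s'.
  move=> [k s]; have [Pks|nP] := pselect (P k s); last by exists s.
  by have [s' Ps' Rs'] := step k s Pks; exists s'.
pose f := fix f k := if k is k'.+1 then F (k', f k') else s0.
have Pf k : P k (f k) by elim: k => // k IH; have [] := FP (k, f k) IH.
by exists f => k; split => //; have [] := FP (k, f k) (Pf k).
Qed.

Section stages.
Variables (X : topologicalType) (T : homeomorphism X X).
Hypotheses (compX : compact [set: X]) (hX : hausdorff_space X).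
Hypotheses (perfX : perfect_set [set: X]) (minT : minimal_system T).
Variables (q : nat -> X -> nat).
Hypotheses (lq : forall n, locally_constant (q n)).
Hypothesis sepq : forall x y, (forall n, q n x = q n y) -> x = y.
Variable (x0 : X).

Record good_stage (n : nat) (s : stage X) : Prop := GoodStage {
  good_is_stage : is_stage T x0 s;
  good_base : forall x, floor_of s x = 0 -> q n x = q n x0;
  good_floors : forall x y, type_of s x = type_of s y -> floor_of s x = floor_of s y ->
    q n x = q n y }.

(** The number of letters of the new stage depends on s only, whereas L is arbitrary. *)
Lemma refine_stage n s L : is_stage T x0 s -> exists2 s', good_stage n s' &
  nletters s' = (ntypes s).*2.+1 /\ exists m, refines T s s' L m.
Proof.
move=> sP; have cP := stage_is_castle sP.
pose d := ntypes s; pose i0 := type_of s x0; pose i1 := type_of s (homeo_inv T x0).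
have i0d : i0 < d by exact: (type_of_lt cP).
have i1d : i1 < d by exact: (type_of_lt cP).
have h0 j : j < d -> 0 < height s j.
  by move=> /(stage_onto sP)[x <-]; have := floor_of_lt cP x; lia.
have [K KP] := castle_refine compX hX perfX minT lq sepq cP (stage_base sP) (stage_onto sP).
have [|ev [N [evL ev_inj evN]]] := fat_vectors K L.+2 _ h0; first by lia.
have [c' [V [[cP' c'onto] qb [c'x0 qf] coV cnt]]] := KP n N.
have ev2 e j : 1 < ev e j by apply: leq_trans (evL e j).
pose cw e := canon d i0 i1 (ev e).
pose len' e := size (body (arr s) (nletters s) id (cw e)).
have /choice[gs gsP] : forall u, exists gs : seq (nat * seq nat), u < ntypes c' -> [/\
    arranged d.*2.+1 len' (sumn (map (height s) (V u)))
             (map (new_block (nletters s) (height s) (arr s) (V u)) gs),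
    perm_eq (flatten (unzip2 gs)) (iota 0 (size (V u))) &
    forall g, g \in gs -> map (nth 0 (V u)) g.2 = cw g.1].
  move=> u; have [uc|uc] := ltnP u (ntypes c'); last by exists [::].
  have [cN cK] := cnt u uc; have [xx [xx0 xxE]] := evN (fun j => count_mem j (V u)) cN cK.
  have [V' VE] := coarser_ends coV uc.
  have [||||gs gsP] := @rearrange d (nletters s) (height s) (len s) (arr s)
    (stage_arranged sP) d.*2.+1 ev xx i0 i1 (V u) V' _ i0d i1d ev2 _ xx0 VE.
  - by have := stage_letters sP; lia.
  - by [].
  - by move=> j; exact: (coarser_lt coV).
  - exact: xxE.
  - by exists gs.
pose arr' u := map (new_block (nletters s) (height s) (arr s) (V u)) (gs u).
have gP u (uc : u < ntypes c') := gsP u uc.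
have arr'P u : u < ntypes c' -> arranged d.*2.+1 len' (sumn (map (height s) (V u))) (arr' u).
  by move=> /gP[].
have s'P : is_stage T x0 (Stage c' d.*2.+1 len' arr').
  by apply: (is_stage_new_stage sP cP' c'x0 c'onto coV i0d i1d (ev := ev)) => // u /gP[].
exists (Stage c' d.*2.+1 len' arr'); first by split.
split => //; eexists; apply: (refines_new_stage sP cP' c'x0 c'onto coV i0d i1d ev2) => //.
- by move=> e j; apply: leq_trans (evL e j); lia.
- by move=> u /gP[].
- by move=> u g /gP[_ _]; apply.
Qed.

Definition coarsest : castle X := Castle 1 (fun=> 0) (fun=> 0) (fun=> 1).

Lemma is_castle_coarsest : is_castle T coarsest.
Proof. by split => //; exact: lc_cst. Qed.

(** Blocks of one point each, with letter 0 on the bottom floor and 1 on the other floors. *)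
Lemma first_stage : exists2 s, good_stage 0 s &
  nletters s = 2 /\ forall e, len s e = 1.
Proof.
have [|K /(_ 0 2)[c' [V [[cP' c'onto] qb [c'x0 qf] coV cnt]]]] :=
  castle_refine compX hX perfX minT lq sepq is_castle_coarsest (x0 := x0) erefl.
  by move=> i; rewrite ltnS leqn0 => /eqP ->; exists x0.
have h2 u : u < ntypes c' -> 1 < height c' u.
  move=> uc; rewrite (coarser_height coV uc); have [/(_ 0 isT)] := cnt u uc.
  move=> /leq_trans c2 _; have -> : map (height coarsest) (V u) = nseq (size (V u)) 1.
    by elim: (V u) => //= v V1 ->.
  by rewrite sumn_nseq mul1n; apply: c2; exact: count_size.
pose arr0 u := [seq ((z != 0) : nat, [:: z]) | z <- iota 0 (height c' u)].
exists (Stage c' 2 (fun=> 1) arr0) => //; split => //; split => // u uc /=.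
have {}h2 := h2 u uc; rewrite /arr0; case: (height c' u) h2 => [|[|h]] // _.
split.
- by rewrite /spread /unzip2 -map_comp flatten_map1 map_id.
- by move=> b /mapP[z _ ->] /=; split => //; case: (z != 0).
- by move=> [|[|]] // _; rewrite !inE.
- by eexists; eexists.
- exists [::], [seq ((z != 0) : nat, [:: z]) | z <- iota 0 h.+1].
  by rewrite -[X in iota 0 X]addn1 iotaD map_cat cats1.
Qed.

Lemma stage_sequence (ell : nat -> stage X -> nat) : exists s : nat -> stage X,
  [/\ nletters (s 0) = 2, forall e, len (s 0) e = 1,
      forall k, good_stage k (s k),
      forall k, nletters (s k.+1) = (ntypes (s k)).*2.+1 &
      forall k, exists m, refines T (s k) (s k.+1) (ell k (s k)) m].
Proof.
pose P k s := good_stage k s /\ (k = 0 -> nletters s = 2 /\ forall e, len s e = 1).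
pose R k (s s' : stage X) := nletters s' = (ntypes s).*2.+1 /\ exists m, refines T s s' (ell k s) m.
have [||f fP] := @dependent_choice_nat _ P R.
- by have [s gs [n2 l1]] := first_stage; exists s.
- move=> k s [[sP _ _] _]; have [s' gs' Rs'] := refine_stage k.+1 (ell k s) sP.
  by exists s'.
have [[_ /(_ erefl)[n2 l1]] _] := fP 0.
by exists f; split => // k; have [[gk _] [nk [m mk]]] := fP k => //; exists m.
Qed.
End stages.

(** * The reordered homeomorphism *)

Section glue.
Variables (X : topologicalType) (Y : Type).
Variables (E : nat -> X -> bool) (g : nat -> X -> Y) (y0 : Y).
Hypotheses (lE : forall k, locally_constant (E k)) (lg : forall k, locally_constant (g k)).

(** The value at the least stage k at which E k x holds; in the applications all such stages
give the same value. *)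
Definition glue (x : X) : Y :=
  match pselect (exists k, E k x) with
  | left ex => g (ex_minn ex) x
  | right _ => y0
  end.

Lemma glueP k x : E k x -> exists2 j, E j x & glue x = g j x.
Proof.
move=> Ek; rewrite /glue; case: pselect => [ex|]; last by case; exists k.
by case: ex_minnP => j Ej _; exists j.
Qed.

Lemma glue_none x : (forall k, ~~ E k x) -> glue x = y0.
Proof.
move=> nE; rewrite /glue; case: pselect => // ex; exfalso.
by case: ex => k; rewrite (negPf (nE k)).
Qed.

Lemma glue_near k x : E k x -> \forall y \near x, glue y = glue x.
Proof.
move=> Ek; have : \forall y \near x, forall j, (j <= k)%N -> E j y = E j x /\ g j y = g j x.
  elim: k {Ek} => [|k IH].
    by apply: filterS2 (lE 0 x) (lg 0 x) => y Ey gy [|//].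
  apply: filterS3 IH (lE k.+1 x) (lg k.+1 x) => y IH Ey gy j.
  by rewrite leq_eqVlt => /predU1P[->//|]; exact: IH.
apply: filterS => y H; have [Eky _] := H k (leqnn k).
rewrite /glue; case: pselect => [exy|[]]; last by exists k; rewrite Eky.
case: pselect => [exx|[]]; last by exists k.
case: ex_minnP => j Ejy minj; case: ex_minnP => i Eix mini.
have jk : (j <= k)%N by apply: minj; rewrite Eky.
have ik : (i <= k)%N by exact: mini.
have [Ei _] := H i ik; have [Ej gj] := H j jk.
have -> : i = j.
  by apply/eqP; rewrite eqn_leq mini ?minj ?Ei // -Ej.
exact: gj.
Qed.
End glue.

Lemma compact_inverse_continuous (X Y : topologicalType) (f : X -> Y) (g : Y -> X) :
  compact [set: X] -> hausdorff_space Y -> continuous f -> cancel f g -> cancel g f ->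
  continuous g.
Proof.
move=> compX hY cf fK gK; apply/continuous_closedP => C clC.
have -> : g @^-1` C = f @` C.
  apply/seteqP; split => [y Cgy|_ [x Cx <-]] /=; last by rewrite fK.
  by exists (g y) => //; exact: gK.
apply: compact_closed => //; apply: continuous_compact.
  exact: continuous_subspaceT.
exact: (subclosed_compact clC compX).
Qed.

Section limit.
Variables (X : topologicalType) (T : homeomorphism X X).
Hypotheses (compX : compact [set: X]) (hX : hausdorff_space X).
Variables (q : nat -> X -> nat) (x0 : X).
Hypothesis sepq : forall x y, (forall n, q n x = q n y) -> x = y.
Variables (s : nat -> stage X) (ell : nat -> nat) (m : nat -> nat -> nat -> nat).
Hypothesis len0 : forall e, len (s 0) e = 1.
Hypothesis gsP : forall k, good_stage T q x0 k (s k).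
Hypothesis ell_gt0 : forall k, 0 < ell k.
Hypothesis refP : forall k, refines T (s k) (s k.+1) (ell k) (m k).

Definition label k := letter_of (s k).
Definition rank k := pos_of (s k).
Definition blen k := len (s k).
Definition run_pos k e a := run_from (blen k) (m k e) a.
Let D k := nletters (s k).
Let sP k : is_stage T x0 (s k). Proof. exact: good_is_stage (gsP k). Qed.
Let cP k : is_castle T (s k). Proof. exact: stage_is_castle (sP k). Qed.

Let xmax := homeo_inv T x0.

Lemma label_lt k x : label k x < D k. Proof. exact: (letter_of_lt (sP k)). Qed.
Lemma rank_lt k x : rank k x < blen k (label k x). Proof. exact: (pos_of_lt (sP k)). Qed.

Lemma letters_gt1 k : 1 < D k. Proof. exact: (stage_letters (sP k)). Qed.

Lemma mult_gt0 k e a : e < D k.+1 -> a < D k -> 0 < m k e a.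
Proof. by move=> eD aD; apply: leq_trans (ell_gt0 k) (refines_mult (refP k) eD aD). Qed.

Lemma run_pos0 k e : run_pos k e 0 = 0. Proof. by rewrite /run_pos /run_from big_ord0. Qed.

Lemma run_posS k e a : run_pos k e a.+1 = run_pos k e a + m k e a * blen k a.
Proof. by rewrite /run_pos /run_from big_ord_recr. Qed.

Lemma run_pos_le k e a b : a <= b -> run_pos k e a <= run_pos k e b.
Proof.
elim: b => [|b IH]; first by rewrite leqn0 => /eqP ->.
rewrite leq_eqVlt => /predU1P[->//|]; rewrite ltnS => /IH ab.
by rewrite (run_posS k e b); apply: leq_trans ab _; exact: leq_addr.
Qed.

Lemma blen_runs k e : e < D k.+1 -> blen k.+1 e = run_pos k e (D k).
Proof. exact: (refines_len (refP k)). Qed.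

Lemma blen_gt0 k e : e < D k -> 0 < blen k e.
Proof.
elim: k e => [|k IH] e eD; first by rewrite /blen len0.
have D0 : 0 < D k by have := letters_gt1 k; lia.
rewrite blen_runs //; apply: leq_trans (run_pos_le _ _ D0).
by rewrite run_posS run_pos0 add0n muln_gt0 mult_gt0 ?IH.
Qed.

Lemma run_pos_lt k e a : e < D k.+1 -> a < D k -> run_pos k e a < run_pos k e a.+1.
Proof.
by move=> eD aD; rewrite run_posS -[X in X < _]addn0 ltn_add2l muln_gt0 mult_gt0 ?blen_gt0.
Qed.

Lemma rank_split k x : exists2 c, c < m k (label k.+1 x) (label k x) &
  rank k.+1 x = run_pos k (label k.+1 x) (label k x) + c * blen k (label k x) + rank k x.
Proof. exact: (refines_pos (refP k)). Qed.

Lemma rank_run k x : run_pos k (label k.+1 x) (label k x) <= rank k.+1 x <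
  run_pos k (label k.+1 x) (label k x).+1.
Proof.
have [c cm ->] := rank_split k x; rewrite -addnA leq_addr /= run_posS ltn_add2l.
apply: (@leq_trans (c.+1 * blen k (label k x))); last by rewrite leq_mul2r cm orbT.
by rewrite mulSn addnC ltn_add2r rank_lt.
Qed.

Lemma rank_mod k x :
  rank k x = (rank k.+1 x - run_pos k (label k.+1 x) (label k x)) %% blen k (label k x).
Proof.
have [c _ ->] := rank_split k x.
by rewrite -addnA addKn modnMDl modn_small // rank_lt.
Qed.

Lemma run_unique k e a b P : run_pos k e a <= P < run_pos k e a.+1 ->
  run_pos k e b <= P < run_pos k e b.+1 -> a = b.
Proof.
move=> /andP[a1 a2] /andP[b1 b2]; case: (ltngtP a b) => // ab.
  by have := leq_trans a2 (leq_trans (run_pos_le k e ab) b1); rewrite ltnn.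
by have := leq_trans b2 (leq_trans (run_pos_le k e ab) a1); rewrite ltnn.
Qed.

Definition has_next k x := (rank k x).+1 < blen k (label k x).

Lemma last_rank k x : ~~ has_next k x -> (rank k x).+1 = blen k (label k x).
Proof. by rewrite /has_next -leqNgt => le; apply/eqP; rewrite eqn_leq le rank_lt. Qed.

Lemma has_nextS k x : has_next k x -> has_next k.+1 x /\
  jump (s k.+1) x (rank k.+1 x).+1 = jump (s k) x (rank k x).+1.
Proof.
move=> upx; split; last exact: (refines_jump (refP k)).
have [c cm PE] := rank_split k x; rewrite /has_next blen_runs ?label_lt // PE -addnS.
apply: leq_trans (run_pos_le _ _ (label_lt k x)); rewrite run_posS -addnA ltn_add2l.
apply: (@leq_trans (c.+1 * blen k (label k x))); last by rewrite leq_mul2r cm orbT.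
by rewrite mulSn addnC ltn_add2r.
Qed.

Lemma has_next_mono k k' x : k <= k' -> has_next k x -> has_next k' x /\
  jump (s k') x (rank k' x).+1 = jump (s k) x (rank k x).+1.
Proof.
move=> /subnKC <- upx; elim: (k' - k) => [|i [ui ji]]; first by rewrite addn0.
by rewrite addnS; have [-> ->] := has_nextS ui.
Qed.

Lemma rank_mono k k' x : k <= k' -> rank k x <= rank k' x.
Proof.
move=> /subnKC <-; elim: (k' - k) => [|i IH]; first by rewrite addn0.
rewrite addnS; apply: leq_trans IH _.
by have [c _ ->] := rank_split (k + i) x; exact: leq_addl.
Qed.

Lemma rank0_x0 x : (forall k, rank k x = 0) -> x = x0.
Proof.
move=> p0; apply: sepq => k; apply: (good_base (gsP k)).
exact: (refines_bottom (refP k) (p0 k.+1)).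
Qed.

Lemma top_floor_xmax x :
  (forall k, (floor_of (s k) x).+1 = height (s k) (type_of (s k) x)) -> x = xmax.
Proof.
move=> top; rewrite /xmax -[LHS](homeo_funK T); congr homeo_inv.
apply: sepq => k; apply: (good_base (gsP k)).
exact: (castle_top (cP k)).
Qed.

Lemma never_next_xmax x : (forall k, ~~ has_next k x) -> x = xmax.
Proof.
move=> nup; apply: top_floor_xmax => k; exact: (refines_top (refP k) (last_rank (nup k.+1))).
Qed.

Lemma x0_block k : label k x0 = 0 /\ rank k x0 = 0.
Proof.
have [l [bs E]] := arr_head (arranged_at (sP k) x0).
have f0 := stage_base (sP k).
have b0 : block_at (s k) x0 = (0, 0 :: l).
  by apply: (block_at_eq (sP k)); rewrite ?f0 ?E mem_head.
by rewrite /label /rank /letter_of /pos_of b0 f0.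
Qed.

Lemma xmax_top k : (floor_of (s k) xmax).+1 = height (s k) (type_of (s k) xmax).
Proof.
apply/eqP; rewrite eqn_leq (floor_of_lt (cP k)) leqNgt /=; apply/negP => lt.
have [_] := castle_up (cP k) lt.
by rewrite /xmax homeo_invK (stage_base (sP k)).
Qed.

(** The last block of a column ends with the top floor, where T^-1 x0 lies. *)
Lemma xmax_block k : label k xmax = (D k).-1 /\ ~~ has_next k xmax.
Proof.
have [l [bs E]] := arr_last (arranged_at (sP k) xmax).
have f1 : floor_of (s k) xmax = (height (s k) (type_of (s k) xmax)).-1.
  by rewrite -xmax_top.
have b1 : block_at (s k) xmax = ((nletters (s k)).-1,
    rcons l (height (s k) (type_of (s k) xmax)).-1).
  apply: (block_at_eq (sP k)); first by rewrite E mem_rcons mem_head.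
  by rewrite f1 mem_rcons mem_head.
split; first by rewrite /label /letter_of b1.
have := block_at_uniq (sP k) xmax; rewrite b1 /= rcons_uniq => /andP[nl _].
rewrite /has_next /rank /blen -(size_block_at (sP k)) /pos_of b1 /= f1 -cats1 index_cat.
by rewrite (negPf nl) /= eqxx addn0 size_cat addn1 ltnn.
Qed.

Definition new_cocycle : X -> int := glue has_next (fun k x => jump (s k) x (rank k x).+1) 1%R.

(** The successor in the blocks of a sufficiently late stage; the point T^-1 x0, last in its
block at every stage, is sent to x0. *)
Definition reordered (x : X) : X := iterz T (new_cocycle x) x.

Lemma lc_label k : locally_constant (label k). Proof. exact: (lc_letter_of (sP k)). Qed.
Lemma lc_rank k : locally_constant (rank k). Proof. exact: (lc_pos_of (sP k)). Qed.

Lemma lc_has_next k : locally_constant (has_next k).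
Proof.
exact: (lc_comp2 (fun p t => p.+1 < blen k t) (lc_rank k) (lc_label k)).
Qed.

Lemma lc_next_jump k : locally_constant (fun x => jump (s k) x (rank k x).+1).
Proof.
apply: (lc_dep (g := fun i x => jump (s k) x i.+1)); first exact: lc_rank.
by move=> i; exact: (lc_jump (sP k)).
Qed.

Lemma new_cocycle_near x : x <> xmax -> \forall y \near x, new_cocycle y = new_cocycle x.
Proof.
move=> xx; have [k upk] : exists k, has_next k x.
  apply: contrapT => nup; apply: xx; apply: never_next_xmax => k.
  by apply/negP => upk; apply: nup; exists k.
exact: (glue_near _ lc_has_next lc_next_jump upk).
Qed.

Lemma reordered_next k x : has_next k x ->
  reordered x = iterz T (jump (s k) x (rank k x).+1) x.
Proof.
move=> upk; rewrite /reordered /new_cocycle.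
have [j upj ->] := glueP (fun k x => jump (s k) x (rank k x).+1) 1%R upk.
have [_ <-] := has_next_mono (leq_maxl j k) upj.
by have [_ <-] := has_next_mono (leq_maxr j k) upk.
Qed.

Lemma reordered_xmax : reordered xmax = x0.
Proof.
rewrite /reordered /new_cocycle glue_none ?iterz1 ?homeo_invK // => k.
by have [] := xmax_block k.
Qed.

Lemma reordered_step k x : has_next k x ->
  label k (reordered x) = label k x /\ rank k (reordered x) = (rank k x).+1.
Proof.
move=> upx; rewrite (reordered_next upx).
have [_ _ bE pE] := jump_block (sP k) upx.
by rewrite /label /rank /letter_of bE pE.
Qed.

(** Inside a block of stage k+1, the last point of a block of stage k is followed by the first
point of another one. *)
Lemma next_rank_zero k x y : label k.+1 y = label k.+1 x -> rank k.+1 y = (rank k.+1 x).+1 ->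
  ~~ has_next k x -> rank k y = 0.
Proof.
move=> tE pE /last_rank top; have [c cm PE] := rank_split k x.
set e := label k.+1 x in tE PE cm; set a := label k x in top PE cm.
have aD : a < D k := label_lt k x; have eD : e < D k.+1 := label_lt k.+1 x.
have {PE} PE : rank k.+1 y = run_pos k e a + c.+1 * blen k a by rewrite pE PE -top; lia.
have := rank_run k y; rewrite tE => yrun.
rewrite rank_mod tE; have [cm'|cm'] := ltnP c.+1 (m k e a).
  have <- : a = label k y.
    apply: run_unique yrun; rewrite PE leq_addr run_posS ltn_add2l ltn_mul2r cm'.
    by rewrite blen_gt0.
  by rewrite PE addKn modnMl.
have mE : c.+1 = m k e a by apply/eqP; rewrite eqn_leq cm cm'.
rewrite mE -run_posS in PE.
have aD' : a.+1 < D k.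
  rewrite ltnNge; apply/negP => Da; have := rank_lt k.+1 y.
  by rewrite tE blen_runs // PE ltnNge run_pos_le.
have <- : a.+1 = label k y.
  by apply: run_unique yrun; rewrite PE leqnn run_pos_lt.
by rewrite PE subnn mod0n.
Qed.

(** Let K be the first stage at which x is not last.  At stage K the successor of x is the next
point of the same block, hence first in its block at all earlier stages. *)
Lemma reordered_top k x : ~~ has_next k x -> rank k (reordered x) = 0.
Proof.
move=> nup; have [->|xx] := EM (x = xmax).
  by rewrite reordered_xmax; have [] := x0_block k.
have [K upK] : exists K, has_next K x.
  apply: contrapT => nupx; apply: xx; apply: never_next_xmax => j.
  by apply/negP => upj; apply: nupx; exists j.
have kK : k <= K.
  rewrite leqNgt; apply/negP => Kk.
  by have [upk _] := has_next_mono (ltnW Kk) upK; rewrite upk in nup.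
have {kK} := subnKC kK; move: (K - k) => i; elim: i k nup => [|i IH] k nup E.
  by rewrite -E addn0 (negPf nup) in upK.
have [upk|nupk] := boolP (has_next k.+1 x).
  by have [tE pE] := reordered_step upk; exact: next_rank_zero nup.
have /IH := nupk; rewrite addSnnS => /(_ E) p0.
by apply/eqP; rewrite -leqn0 -p0; exact: rank_mono.
Qed.

Definition ordered_castle k : castle X := Castle (D k) (label k) (rank k) (blen k).

Lemma is_castle_ordered k : is_castle reordered (ordered_castle k).
Proof.
split => /=; [exact: lc_label|exact: lc_rank|exact: label_lt|exact: rank_lt| |].
  by move=> x; exact: reordered_step.
move=> x top; apply: reordered_top.
by rewrite /has_next top ltnn.
Qed.

Lemma has_next_before k x : rank k (reordered x) != 0 -> has_next k x.
Proof. by apply: contra_neqT => /reordered_top. Qed.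

Lemma reordered_inj : injective reordered.
Proof.
move=> x y xy; have [w0|w0] := EM (forall k, rank k (reordered x) = 0).
  have top z : reordered z = reordered x -> z = xmax.
    move=> zx; apply: never_next_xmax => k; apply/negP => /reordered_step[_].
    by rewrite zx w0.
  by rewrite (top x) // (top y).
have /existsNP[k /eqP w] := w0.
have upx := has_next_before w; have upy : has_next k y by apply: has_next_before; rewrite -xy.
have back z : has_next k z ->
    z = iterz T (jump (s k) (reordered z) (rank k (reordered z)).-1) (reordered z).
  move=> upz; have [_ ->] := reordered_step upz.
  rewrite /= (reordered_next upz) (jump_jump (sP k) _ upz).
  by rewrite (jump_pos (sP k)).
by rewrite (back x upx) (back y upy) xy.
Qed.

Lemma reordered_surj w : exists x, reordered x = w.
Proof.
have [w0|/existsNP[k /eqP pw]] := EM (forall k, rank k w = 0).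
  by exists xmax; rewrite reordered_xmax (rank0_x0 w0).
have lt : (rank k w).-1 < len (s k) (letter_of (s k) w).
  by apply: leq_ltn_trans (leq_pred _) (rank_lt k w).
have [tE fE bE pE] := jump_block (sP k) lt.
exists (iterz T (jump (s k) w (rank k w).-1) w).
have upx : has_next k (iterz T (jump (s k) w (rank k w).-1) w).
  rewrite /has_next /rank /label /letter_of bE pE prednK ?lt0n //; exact: rank_lt.
rewrite (reordered_next upx) (jump_jump (sP k) _ lt) /rank pE prednK ?lt0n //.
by rewrite (jump_pos (sP k)).
Qed.

(** The sets of points that are first in their blocks decrease to x0. *)
Lemma bottom_small (V : set X) : nbhs x0 V -> exists k, forall x, rank k x = 0 -> V x.
Proof.
rewrite nbhsE => -[O [oO Ox0] OV].
have /choice[kk kkP] : forall y, exists k, ~ O y -> 0 < rank k y.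
  move=> y; have [Oy|nOy] := EM (O y); first by exists 0.
  apply: contrapT => /forallNP H; apply: nOy; rewrite (@rank0_x0 y) // => k.
  by have /not_implyP[_ /negP] := H k; rewrite -eqn0Ngt => /eqP.
pose U y := if pselect (O y) then O else [set z | 0 < rank (kk y) z].
have [y|r rP] := @compact_finite_subcover _ compX U.
  rewrite /U; case: pselect => [Oy|nOy]; first exact: open_nbhs_nbhs.
  have py := kkP _ nOy; by apply: filterS (lc_rank (kk y) y) => z /= ->.
exists (\max_(y <- r) kk y) => x px0; apply: OV; have [y yr] := rP x.
rewrite /U; case: pselect => // _ /= py; have := @leq_bigmax_seq _ r xpredT kk y yr isT.
by move=> /(rank_mono x); rewrite px0; move: py; case: (rank _ x).
Qed.

(** Near T^-1 x0 points are last in their blocks at a late stage, so their images are first in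
their blocks, hence close to x0. *)
Lemma reordered_continuous : continuous reordered.
Proof.
move=> x; have [->|xx] := EM (x = xmax).
  move=> V; rewrite reordered_xmax => /bottom_small[k kV].
  have [_ nup] := xmax_block k.
  apply: filterS (lc_has_next k xmax) => y upy; apply: kV; apply: reordered_top.
  by rewrite upy.
move=> V /= VT; have cT := @continuous_iterz _ T (new_cocycle x) x V VT.
apply: filterS2 (new_cocycle_near xx) cT => y yn Vy.
by rewrite /= /reordered yn.
Qed.

Definition reordered_inv : X -> X := projT1 (choice reordered_surj).

Lemma reordered_invK : cancel reordered_inv reordered.
Proof. by move=> x; rewrite /reordered_inv; case: choice => g /= gP. Qed.

Lemma reorderedK : cancel reordered reordered_inv.
Proof. by move=> x; apply: reordered_inj; rewrite reordered_invK. Qed.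

Definition reordered_homeo : homeomorphism X X :=
  Homeomorphism reorderedK reordered_invK reordered_continuous
    (compact_inverse_continuous compX hX reordered_continuous reorderedK reordered_invK).

Lemma reordered_iter k x i : rank k x + i < blen k (label k x) ->
  iter i reordered x = iterz T (jump (s k) x (rank k x + i)) x.
Proof.
elim: i => [|i IH]; first by rewrite addn0 (jump_pos (sP k)).
rewrite addnS => lt; rewrite iterS IH ?(ltnW lt) //.
have lt' := ltnW lt; have [tE fE bE pE] := jump_block (sP k) lt'.
rewrite (@reordered_next k) /rank ?pE ?(jump_jump (sP k) _ lt') //.
by rewrite /has_next /rank pE /label /letter_of bE.
Qed.

Definition below_top k x := (floor_of (s k) x).+1 < height (s k) (type_of (s k) x).

Definition old_cocycle : X -> int :=
  glue below_top (fun k x => ((rank k.+1 (T x))%:Z - (rank k.+1 x)%:Z)%R) 1%R.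

(** A point and its image under T lie in the same column of some stage, hence in the same block
of the next one, unless the point is T^-1 x0. *)
Lemma T_reordered x : T x = iterz reordered_homeo (old_cocycle x) x.
Proof.
have [[k ck]|nc] := EM (exists k, below_top k x); last first.
  have nck k : ~~ below_top k x by apply/negP => ck; apply: nc; exists k.
  rewrite /old_cocycle glue_none // iterz1 /=.
  have -> : x = xmax.
    apply: top_floor_xmax => k; apply/eqP; rewrite eqn_leq (floor_of_lt (cP k)) /=.
    by rewrite leqNgt; exact: nck.
  by rewrite reordered_xmax /xmax homeo_invK.
rewrite /old_cocycle;
have [j cj ->] := glueP (fun k x => ((rank k.+1 (T x))%:Z - (rank k.+1 x)%:Z)%R) 1%R ck.
have [tE fE bE] := refines_same (refP j) cj.
pose b y := iterz T (jump (s j.+1) y 0) y.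
have l0 y : 0 < blen j.+1 (label j.+1 y) by have := rank_lt j.+1 y; lia.
have bP y : iter (rank j.+1 y) reordered (b y) = y.
  have [tb fb bb pb] := jump_block (sP j.+1) (l0 y).
  rewrite (@reordered_iter j.+1) /b; last first.
    by rewrite /rank /label /letter_of pb bb; exact: rank_lt.
  by rewrite {1}/rank pb add0n (jump_jump (sP j.+1) _ (l0 y)) (jump_pos (sP j.+1)).
have bT : b (T x) = b x.
  rewrite /b /jump bE fE -[in LHS](iterz1 T x) -iterzD; congr iterz; lia.
have E1 : iterz reordered_homeo (rank j.+1 x)%:Z%R (b x) = x by exact: bP.
have E2 : iterz reordered_homeo (rank j.+1 (T x))%:Z%R (b x) = T x by rewrite -bT; exact: bP.
suff E3 : iterz reordered_homeo ((rank j.+1 (T x))%:Z - (rank j.+1 x)%:Z)%R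
    (iterz reordered_homeo (rank j.+1 x)%:Z%R (b x)) = T x by rewrite E1 in E3.
by rewrite -iterzD subrK.
Qed.

Lemma old_cocycle_near x : x <> xmax -> \forall y \near x, old_cocycle y = old_cocycle x.
Proof.
move=> xx; have [k ck] : exists k, below_top k x.
  apply: contrapT => nc; apply: xx; apply: top_floor_xmax => k.
  apply/eqP; rewrite eqn_leq (floor_of_lt (cP k)) leqNgt /=; apply/negP => ck.
  by apply: nc; exists k.
apply: glue_near ck => j.
  exact: (lc_comp2 (fun z t => z.+1 < height (s j) t) (lc_floor_of (cP j)) (lc_type_of (cP j))).
apply: (lc_comp2 (fun a b : nat => (a%:Z - b%:Z)%R) _ (lc_rank j.+1)).
by apply: (lc_iter T 1 (lc_rank j.+1)).
Qed.

(** * Recognizability and complexity of the coding *)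

Hypothesis two_letters : nletters (s 0) = 2.

Let R := reordered_homeo.

(** Letters increase along a block from 0 to the last letter, so they drop from the last letter
to 0 only between two blocks. *)
Lemma bottom_letters k w : rank k.+1 w = 0 <->
  [/\ rank k w = 0, label k w = 0 & label k (homeo_inv R w) = (D k).-1].
Proof.
set v := homeo_inv R w; have Rv : reordered v = w by exact: (homeo_invK R).
have D1 := letters_gt1 k.
have := rank_run k v; have := rank_run k w; set e := label k.+1 w.
split=> [w0|[pw tw tv]].
  have nup : ~~ has_next k.+1 v.
    by apply/negP => /reordered_step[_]; rewrite Rv w0.
  have pw : rank k w = 0 by apply/eqP; rewrite -leqn0 -w0; exact: rank_mono.
  split => //.
    apply: (@run_unique k e _ _ 0); first by rewrite -w0 rank_run.
    by rewrite run_pos0 /= -{1}(run_pos0 k e) run_pos_lt ?label_lt //; lia.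
  have top := last_rank nup; rewrite blen_runs ?label_lt // in top.
  apply: run_unique (rank_run k v) _; rewrite prednK; last by lia.
  rewrite -top ltnSn andbT -ltnS top.
  by rewrite -[in X in _ < X](prednK (ltnW D1)) run_pos_lt ?label_lt //; lia.
apply/eqP; apply: contraTT (D1); rewrite -lt0n => w0.
have upv : has_next k.+1 v by apply: has_next_before; rewrite Rv -lt0n.
have [tE pE] := reordered_step upv; rewrite Rv in tE pE.
have : label k v = 0.
  apply: run_unique (rank_run k v) _; rewrite run_pos0 /=.
  have := rank_run k w; rewrite tw pE tE => /andP[_]; exact: ltnW.
by rewrite tv; lia.
Qed.

Lemma castle_bottoms (c : castle X) x y : is_castle R c ->
  (forall i, floor_of c (iterz R i x) = 0 <-> floor_of c (iterz R i y) = 0) ->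
  floor_of c x = floor_of c y /\ height c (type_of c x) = height c (type_of c y).
Proof.
move=> Rc bots.
have half x' y' : (forall i, floor_of c (iterz R i x') = 0 <-> floor_of c (iterz R i y') = 0) ->
    floor_of c x' <= floor_of c y' -> floor_of c x' = floor_of c y'.
  move=> b le; have [_ fx] := castle_back Rc (leqnn (floor_of c x')).
  have [_ fy] := castle_back Rc le.
  have /b : floor_of c (iterz R (- (floor_of c x')%:Z)%R x') = 0 by rewrite fx subnn.
  by rewrite fy; lia.
have fxy : floor_of c x = floor_of c y.
  have [le|le] := leqP (floor_of c x) (floor_of c y); first exact: half.
  by symmetry; apply: half; [move=> i; split=> /bots|exact: ltnW].
split => //.
have halfh x' y' : (forall i, floor_of c (iterz R i x') = 0 <-> floor_of c (iterz R i y') = 0) ->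
    floor_of c x' = floor_of c y' -> height c (type_of c y') <= height c (type_of c x').
  move=> b fE; have := castle_next_base Rc x'; set n := _ - _ => base.
  have /b : floor_of c (iterz R n%:Z%R x') = 0 by exact: base.
  rewrite iterz_nat => base'.
  rewrite leqNgt; apply/negP => lt; have := floor_of_lt Rc x' => lt'.
  have [|_] := @castle_iter _ _ _ Rc y' n; first by rewrite /n -fE; lia.
  by rewrite base' /n; lia.
apply/eqP; rewrite eqn_leq halfh //=; first by apply: halfh.
by move=> i; split=> /bots.
Qed.

(** By induction on k the coding determines all the blocks of stage k: the beginnings of blocks
are found by [bottom_letters], their letters by their lengths.  Blocks of all stages
separate points. *)
Lemma recognizable x y :
  (forall i, label 0 (iterz R i x) = label 0 (iterz R i y)) -> x = y.
Proof.
move=> E0.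
have E k : forall i, label k (iterz R i x) = label k (iterz R i y) /\
    rank k (iterz R i x) = rank k (iterz R i y).
  elim: k => [|k IH] i.
    split => //; have := rank_lt 0 (iterz R i x); have := rank_lt 0 (iterz R i y).
    by rewrite /blen !len0; lia.
  have bots j : rank k.+1 (iterz R j x) = 0 -> rank k.+1 (iterz R j y) = 0.
    move/bottom_letters; rewrite -!iterzP => -[px tx tx'].
    apply/bottom_letters; rewrite -!iterzP.
    have [<- <-] := IH j; have [<- _] := IH (j - 1)%R.
    by split.
  have bots' j : rank k.+1 (iterz R j y) = 0 -> rank k.+1 (iterz R j x) = 0.
    move/bottom_letters; rewrite -!iterzP => -[px tx tx'].
    apply/bottom_letters; rewrite -!iterzP.
    have [-> ->] := IH j; have [-> _] := IH (j - 1)%R.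
    by split.
  have [|pE hE] := @castle_bottoms _ (iterz R i x) (iterz R i y) (is_castle_ordered k.+1).
    by move=> j; rewrite -!iterzD; split; [exact: bots|exact: bots'].
  split => //; apply: (refines_len_inj (refP k)) hE; exact: label_lt.
apply: sepq => k.
have [tE pE] := E k.+1 0%R; rewrite !iterz0 in tE pE.
by have [t f] := refines_sep (refP k) tE pE; exact: (good_floors (gsP k)).
Qed.

Lemma code_down k x y : label k x = label k y -> rank k x = rank k y -> label 0 x = label 0 y.
Proof.
elim: k => // k IH tE pE.
have lE : label k x = label k y.
  by apply: run_unique (rank_run k x) _; rewrite tE pE rank_run.
by apply: IH => //; rewrite (rank_mod k x) (rank_mod k y) tE pE lE.
Qed.

(** Once the letters in a window are known, a position at one time determines the positions at
all times, since it grows by one or drops to zero at the end of the block. *)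
Lemma window k n j x y : j < n ->
  (forall i, i < n -> label k (iter i R x) = label k (iter i R y)) ->
  rank k (iter j R x) = rank k (iter j R y) ->
  forall i, i < n -> label 0 (iter i R x) = label 0 (iter i R y).
Proof.
move=> jn letters pj i iN; apply: (code_down (k := k)); first exact: letters.
have fwd i' : j + i' < n -> rank k (iter (j + i') R x) = rank k (iter (j + i') R y).
  elim: i' => [|i' IH]; first by rewrite addn0.
  rewrite addnS => lt; have {}IH := IH (ltnW lt); have lE := letters _ (ltnW lt).
  have [upx|nupx] := boolP (has_next k (iter (j + i') R x)).
    have upy : has_next k (iter (j + i') R y) by rewrite /has_next -lE -IH.
    have [_ px] := reordered_step upx; have [_ py] := reordered_step upy.
    by rewrite !iterS px py IH.
  have nupy : ~~ has_next k (iter (j + i') R y) by rewrite /has_next -lE -IH.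
  by rewrite !iterS !reordered_top.
have bwd i' : i' <= j -> rank k (iter (j - i') R x) = rank k (iter (j - i') R y).
  elim: i' => [|i' IH] le; first by rewrite subn0.
  have {IH} := IH (ltnW le); rewrite -(subnSK le) !iterS /=.
  have lE := letters (j - i'.+1) (leq_ltn_trans (leq_subr _ _) jn).
  set w := iter (j - i'.+1) reordered x in lE *; set v := iter (j - i'.+1) reordered y in lE *.
  have [upx|nupx] := boolP (has_next k w); have [upy|nupy] := boolP (has_next k v).
  - by have [_ ->] := reordered_step upx; have [_ ->] := reordered_step upy; case.
  - by have [_ ->] := reordered_step upx; rewrite (reordered_top nupy).
  - by have [_ ->] := reordered_step upy; rewrite (reordered_top nupx).
  - by move=> _; have := last_rank nupx; have := last_rank nupy; rewrite lE => <- [].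
have [ij|ji] := leqP i j.
  by rewrite -(subKn ij) bwd // leq_subr.
by rewrite -(subnKC (ltnW ji)) fwd // subnKC // ltnW.
Qed.

(** The letters run cyclically through 0, ..., D_k - 1, and a new letter starts at a place of the
block of stage k+1 that depends only on the two letters. *)
Lemma letter_change k w : label k w <> label k (R w) ->
  [/\ rank k.+1 (R w) = run_pos k (label k.+1 (R w)) (label k (R w)),
      rank k (R w) = 0 &
      label k w = (if label k (R w) is b.+1 then b else (D k).-1)].
Proof.
move=> chg; have [y0|y0] := posnP (rank k.+1 (R w)).
  have /bottom_letters[py ty tw] := y0; rewrite homeo_funK in tw.
  by rewrite y0 py ty run_pos0 tw.
have upw : has_next k.+1 w by apply: has_next_before; rewrite -lt0n.
have [tE pE] := reordered_step upw.
have wrun := rank_run k w; have yrun := rank_run k (R w); rewrite /= tE pE in yrun *.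
have lE : label k (R w) = (label k w).+1.
  have PE : (rank k.+1 w).+1 = run_pos k (label k.+1 w) (label k w).+1.
    apply/eqP; rewrite eqn_leq; have /andP[w1 w2] := wrun; rewrite w2 /= leqNgt.
    apply/negP => lt; apply: chg; apply: run_unique yrun.
    by rewrite lt leqW.
  have aD : (label k w).+1 < D k.
    rewrite ltnNge; apply/negP => Da; have := upw; rewrite /has_next blen_runs ?label_lt // PE.
    by rewrite ltnNge run_pos_le.
  symmetry; apply: run_unique yrun; rewrite PE leqnn run_pos_lt ?label_lt //.
have PE : (rank k.+1 w).+1 = run_pos k (label k.+1 w) (label k w).+1.
  apply/eqP; rewrite eqn_leq; have /andP[_ ->] := wrun.
  by have /andP[+ _] := yrun; rewrite /= lE.
split; rewrite /= in lE *; rewrite ?lE //.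
by rewrite rank_mod tE pE lE PE subnn mod0n.
Qed.

Lemma run_forward k y i : rank k.+1 y = run_pos k (label k.+1 y) (label k y) -> i < ell k ->
  label k (iter i R y) = label k y.
Proof.
move=> pE ilt; set e := label k.+1 y in pE; set b := label k y in pE *.
have bD : b < D k := label_lt k y; have eD : e < D k.+1 := label_lt k.+1 y.
have lt : run_pos k e b + i < run_pos k e b.+1.
  rewrite run_posS ltn_add2l; apply: leq_trans ilt _.
  apply: leq_trans (refines_mult (refP k) eD bD) _.
  by rewrite -[X in X <= _]muln1 leq_mul2l blen_gt0 // orbT.
have [|/= tE fE] := @castle_iter _ _ _ (is_castle_ordered k.+1) y i.
  by rewrite /= pE -/e blen_runs //; apply: leq_trans lt (run_pos_le _ _ bD).
by apply: run_unique (rank_run k _) _; rewrite tE fE pE lt leq_addr.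
Qed.

Section words.
Variables (k n : nat).
Hypotheses (n0 : 0 < n) (n_len : forall b, b < D k -> blen k b <= n).
Hypothesis n_ell : n <= ell k.+1.

(** The first change of letter of stage j in the window of length n starting at x, or n - 1 if
there is none. *)
Definition change_time j (x : X) : nat :=
  find (fun i => label j (iter i R x) != label j (iter i.+1 R x)) (iota 0 n.-1).

Lemma change_time_le j x : change_time j x <= n.-1.
Proof. by rewrite -[X in _ <= X](size_iota 0); exact: find_size. Qed.

Lemma before_change j x i : i <= change_time j x -> label j (iter i R x) = label j x.
Proof.
elim: i => // i IH lt; rewrite -(IH (ltnW lt)).
have := before_find 0 lt; rewrite nth_iota; last exact: leq_trans lt (change_time_le j x).
by move=> /negbFE/eqP ->.
Qed.

Lemma at_change j x : change_time j x < n.-1 ->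
  label j (iter (change_time j x) R x) <> label j (R (iter (change_time j x) R x)).
Proof.
move=> lt; have /(nth_find 0) : has (fun i => label j (iter i R x) !=
    label j (iter i.+1 R x)) (iota 0 n.-1).
  by rewrite has_find size_iota.
by rewrite nth_iota // => /eqP.
Qed.

(** The tag 0, 1 or 2 tells which changes occur in the window: none at stage k; some at stage k
but none at stage k+1; some at stage k+1. *)
Definition word_code (x : X) : (nat * nat) * (nat * nat) :=
  let t := change_time k x in let t' := change_time k.+1 x in
  if t == n.-1 then ((0, rank k x), (label k x, 0))
  else if t' == n.-1 then ((1, t.+1), (label k (iter t.+1 R x), label k.+1 x))
  else ((2, t'.+1), (0, label k.+1 (iter t'.+1 R x))).

Lemma letters_before j x y : change_time j x = n.-1 -> change_time j y = n.-1 ->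
  label j x = label j y -> forall i, i < n -> label j (iter i R x) = label j (iter i R y).
Proof. by move=> tx ty E i lt; rewrite !before_change ?tx ?ty //; lia. Qed.

(** In the third case there is only one change of stage k+1, because runs are longer than the
window; the letter before it is the predecessor of the letter after it. *)
Lemma word_codeP x y : word_code x = word_code y ->
  forall i, i < n -> label 0 (iter i R x) = label 0 (iter i R y).
Proof.
rewrite /word_code.
have lt_t j z : change_time j z != n.-1 -> change_time j z < n.-1.
  by rewrite ltn_neqAle change_time_le andbT.
case: ifPn => [/eqP tx|/lt_t tx].
  case: ifPn => [/eqP ty [pE lE]|ty]; last by case: ifP.
  by apply: (@window k n 0) => //; exact: letters_before.
case: ifPn => [/eqP tx'|/lt_t tx']; (case: ifPn => [/eqP ty|/lt_t ty]; first by []);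
  case: ifPn => [/eqP ty'|/lt_t ty'] //.
  move=> -[tE bE eE]; have lets := letters_before tx' ty' eE.
  have tn : (change_time k x).+1 < n by lia.
  apply: (@window k.+1 n (change_time k x).+1) => //.
  have [px _ _] := letter_change (at_change tx).
  have [py _ _] := letter_change (at_change ty).
  rewrite [in RHS]tE !iterS px py -!iterS -bE -tE lets //.
move=> -[tE bE]; have tn : (change_time k.+1 x).+1 < n by lia.
have [px p0x ax] := letter_change (at_change tx').
have [py p0y ay] := letter_change (at_change ty').
apply: (@window k.+1 n (change_time k.+1 x).+1) => //; last first.
  by rewrite [in RHS]tE !iterS p0x p0y.
move=> i lt; have [it|ti] := leqP i (change_time k.+1 x).
  rewrite !before_change -?tE //.
  by rewrite -(before_change (leqnn _)) ax -(before_change (x := y) (leqnn _)) ay -!iterS bE.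
have le : i - (change_time k.+1 x).+1 < ell k.+1.
  by apply: leq_trans n_ell; lia.
have ex := run_forward px le; rewrite -iterS -iterD subnK // in ex.
rewrite tE in le ti; have ey := run_forward py le.
by rewrite -iterS -iterD subnK // in ey; rewrite ex ey bE.
Qed.

Definition all_codes : seq ((nat * nat) * (nat * nat)) :=
  [seq (a, b) | a <- [seq (i, j) | i <- iota 0 3, j <- iota 0 n],
                b <- [seq (i, j) | i <- iota 0 (D k), j <- iota 0 (D k.+1)]].

Lemma word_code_in x : word_code x \in all_codes.
Proof.
have D0 j : 0 < D j by have := letters_gt1 j; lia.
have inP a b c d : a < 3 -> b < n -> c < D k -> d < D k.+1 -> ((a, b), (c, d)) \in all_codes.
  by move=> *; apply: allpairs_f; apply: allpairs_f; rewrite mem_iota.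
rewrite /word_code; case: ifPn => [_|tx].
  apply: inP => //; last exact: label_lt.
  by apply: leq_trans (rank_lt k x) (n_len _); exact: label_lt.
have tn j : change_time j x != n.-1 -> (change_time j x).+1 < n.
  by have := change_time_le j x; lia.
by case: ifPn => [_|tx']; apply: inP; rewrite ?label_lt ?tn.
Qed.

(** Two symbols suffice: the letters of stage 0. *)
Definition code (x : X) : full_shift bool := fun i : int => label 0 (iterz R i x) == 0.

Lemma complexity_code : complexity (range code) n <= 3 * (D k * D k.+1) * n.
Proof.
have -> : 3 * (D k * D k.+1) * n = size all_codes.
  by rewrite !size_allpairs !size_iota; lia.
pose P := [pred w : n.-tuple bool | `[< occurs (range code) w >]].
have /choice[pt ptP] : forall w : n.-tuple bool, exists x : option X, w \in P ->
    exists2 z, x = Some z & forall j : 'I_n, (label 0 (iter j R z) == 0) = tnth w j.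
  move=> w; have [/asboolP[_ [x _ <-] [i wE]]|nw] := boolP (w \in P); last by exists None.
  exists (Some (iterz R i x)) => _; exists (iterz R i x) => // j; rewrite -wE /code.
  by rewrite -iterz_nat -iterzD addrC.
pose cd w := if pt w is Some x then word_code x else ((0, 0), (0, 0)).
rewrite /complexity -/P cardE -(size_map cd); apply: uniq_leq_size.
  rewrite map_inj_in_uniq ?enum_uniq // => w w'; rewrite !mem_enum => /ptP[z E H] /ptP[z' E' H'].
  rewrite /cd E E' => /word_codeP c; apply: eq_from_tnth => j.
  by rewrite -H -H' c.
move=> _ /mapP[w + ->]; rewrite mem_enum => /ptP[z E _]; rewrite /cd E.
exact: word_code_in.
Qed.
End words.

Lemma code_shift x : code (R x) = shift_homeo bool (code x).
Proof.
apply/funext => i; rewrite /code /shift_homeo /= /shift_fun.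
by have -> : iterz R (i + 1)%R x = iterz R i (R x) by rewrite iterzD.
Qed.

Lemma code_inj : injective code.
Proof.
move=> x y E; apply: recognizable => i.
have D2 z : label 0 z < 2 by rewrite -[X in _ < X]two_letters; exact: label_lt.
have : (label 0 (iterz R i x) == 0) = (label 0 (iterz R i y) == 0).
  by have := congr1 (fun c : full_shift bool => c i) E.
by have := D2 (iterz R i x); have := D2 (iterz R i y); lia.
Qed.

Lemma lc_code (i : int) : locally_constant (fun x => code x i).
Proof. exact: (lc_iterz R i (lc_comp (fun l => l == 0) (lc_label 0))). Qed.

Lemma reordered_system : exists (R : homeomorphism X X) (f : X -> full_shift bool)
    (nu1 nu2 : X -> int), [/\
  [/\ forall i : int, locally_constant (fun x => f x i), injective f &
      forall x, f (R x) = shift_homeo bool (f x)],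
  (forall x, R x = iterz T (nu1 x) x) /\ (forall x, T x = iterz R (nu2 x) x),
  (forall x, x <> xmax -> \forall y \near x, nu1 y = nu1 x),
  (forall x, x <> xmax -> \forall y \near x, nu2 y = nu2 x) &
  forall k n, 0 < n -> (forall b, b < D k -> blen k b <= n) -> n <= ell k.+1 ->
    complexity (range f) n <= 3 * (D k * D k.+1) * n].
Proof.
exists R, code, new_cocycle, old_cocycle; split.
- by split; [exact: lc_code|exact: code_inj|exact: code_shift].
- by split=> x //; exact: T_reordered.
- exact: new_cocycle_near.
- exact: old_cocycle_near.
- exact: complexity_code.
Qed.

End limit.

(** * From the coding to a strongly orbit equivalent subshift *)

Lemma orbit_power (X : topologicalType) (T R : homeomorphism X X) :
  (forall x, exists j, R x = iterz T j x) ->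
  forall k x, exists j, iterz R k x = iterz T j x.
Proof.
move=> RT; have RT' x : exists j, homeo_inv R x = iterz T j x.
  have [j E] := RT (homeo_inv R x); exists (- j)%R.
  by rewrite homeo_invK in E; rewrite {2}E iterzK.
have pw (f : X -> X) n x : (forall x, exists j, f x = iterz T j x) ->
    exists j, iter n f x = iterz T j x.
  move=> fT; elim: n => [|n [j IH]]; first by exists 0%R.
  by have [i E] := fT (iter n f x); exists (i + j)%R; rewrite iterS E IH iterzD.
by case=> n x; exact: pw.
Qed.

Lemma hausdorff_full_shift (A : finType) : hausdorff_space (full_shift A).
Proof. by apply: hausdorff_product => i; exact: discrete_hausdorff. Qed.

Lemma continuous_code (X : topologicalType) (A : finType) (f : X -> full_shift A) :
  (forall i : int, locally_constant (fun x => f x i)) -> continuous f.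
Proof.
move=> lf; suff : continuous (f : X -> prod_topology (fun _ : int => discrete_topology A)) by [].
move=> x; apply/cvg_sup => i U [_ [[V oV <-] Vx] VU].
by apply: filterS (lf i x) => y /= E; apply: VU => /=; rewrite E.
Qed.

Section coded_system.
Variables (X : topologicalType) (T R : homeomorphism X X) (A : finType).
Hypotheses (compX : compact [set: X]) (minT : minimal_system T).
Variable f : X -> full_shift A.
Hypotheses (cf : continuous f) (f_inj : injective f).
Hypothesis fR : forall x, f (R x) = shift_homeo A (f x).

Let closed_image (C : set X) : closed C -> closed (f @` C).
Proof.
move=> clC; apply: compact_closed; first exact: hausdorff_full_shift.
apply: continuous_compact; first exact: continuous_subspaceT.
exact: (subclosed_compact clC compX).
Qed.

Let closed_range : closed (range f). Proof. exact/closed_image/closedT. Qed.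

Let shift_range : shift_homeo A @` range f = range f.
Proof.
apply/seteqP; split=> [_ [_ [x _ <-] <-]|_ [x _ <-]].
  by exists (R x); rewrite // fR.
exists (f (homeo_inv R x)); first by exists (homeo_inv R x).
by rewrite -fR homeo_invK.
Qed.

Definition coded_subshift : subshift A := Subshift closed_range shift_range.

Let S := subshift_homeo coded_subshift.

Let to_code (x : X) : set_type coded_subshift :=
  exist _ (f x) (mem_set (imageT f x)).

Let decode_ex (y : set_type coded_subshift) : exists x, f x = set_val y.
Proof. by have [x _ E] := set_valP y; exists x. Qed.

Let decode (y : set_type coded_subshift) : X := projT1 (cid (decode_ex y)).

Let f_decode y : f (decode y) = set_val y.
Proof. by rewrite /decode; case: cid. Qed.

Let decodeK : cancel decode to_code.
Proof. by move=> y; apply: val_inj; exact: f_decode. Qed.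

Let to_codeK : cancel to_code decode.
Proof. by move=> x; apply: f_inj; rewrite f_decode. Qed.

Let continuous_to_code : continuous to_code.
Proof. exact: continuous_comp_initial. Qed.

Let continuous_decode : continuous decode.
Proof.
apply/continuous_closedP => C clC.
have -> : decode @^-1` C = set_val @^-1` (f @` C).
  apply/seteqP; split=> [y Cy|y [x Cx E]] /=; first by exists (decode y).
  by have -> : decode y = x by apply: f_inj; rewrite f_decode.
apply: preimage_closed; last exact: closed_image.
by move=> y _; exact: initial_continuous.
Qed.

Definition decoding : homeomorphism (set_type coded_subshift) X :=
  Homeomorphism decodeK to_codeK continuous_decode continuous_to_code.

Lemma decoding_shift y : decoding (S y) = R (decoding y).
Proof. by apply: f_inj; rewrite fR /= f_decode /= f_decode. Qed.

Lemma decoding_iterz k y : decoding (iterz S k y) = iterz R k (decoding y).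
Proof.
elim/int_rec: k => [//|n IH|n IH].
  by rewrite -addn1 PoszD !iterzS decoding_shift IH.
have -> : (- n.+1%:Z = - n%:Z - 1 :> int)%R by lia.
by rewrite !iterzP -IH -[in RHS](homeo_invK S (iterz S _ y)) decoding_shift homeo_funK.
Qed.

Variables (nu1 nu2 : X -> int) (z : X).
Hypothesis nu1P : forall x, R x = iterz T (nu1 x) x.
Hypothesis nu2P : forall x, T x = iterz R (nu2 x) x.
Hypothesis nu1_near : forall x, x <> z -> \forall y \near x, nu1 y = nu1 x.
Hypothesis nu2_near : forall x, x <> z -> \forall y \near x, nu2 y = nu2 x.

Let orbitE x : orbitz R x = orbitz T x.
Proof.
apply/seteqP; split=> _ [k _ <-].
  by have [|j ->] := @orbit_power _ T R _ k x; [move=> w; exists (nu1 w)|exists j].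
by have [|j ->] := @orbit_power _ R T _ k x; [move=> w; exists (nu2 w)|exists j].
Qed.

Lemma coded_minimal : minimal_system S.
Proof.
move=> y O [o Oo] oO.
have oO' : open (to_code @^-1` O).
  by apply: open_comp => // x _; exact: continuous_to_code.
have [|x [Ox]] := minT (decode y) _ oO'; first by exists (decode o); rewrite /= decodeK.
rewrite -orbitE => -[k _ kx]; exists (to_code x); split => //.
by exists k => //; rewrite -kx -(decoding_iterz k y) /= decodeK.
Qed.

Let one_discontinuity (nu : X -> int) :
  (forall x, x <> z -> \forall y \near x, nu y = nu x) ->
  at_most_one_discontinuity (fun y => nu (decode y) : discrete_topology int).
Proof.
move=> near_nu; suff cont y : decode y <> z ->
    {for y, continuous (fun y => nu (decode y) : discrete_topology int)}.
  move=> y y' /(contra_notP (cont y)) yz /(contra_notP (cont y')) yz'.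
  by rewrite -(decodeK y) yz -yz' decodeK.
move=> yz V /nbhs_singleton Vy.
have Hy : nbhs y [set y' | nu (decode y') = nu (decode y)].
  exact: continuous_decode (near_nu _ yz).
by apply: filterS Hy => y' /= E; rewrite /= E.
Qed.

Lemma coded_strong_orbit_equivalent : strong_orbit_equivalent S T.
Proof.
exists decoding; split.
  move=> y; apply/seteqP; split=> [_ [_ [k _ <-] <-]|x].
    by rewrite decoding_iterz -orbitE; exists k.
  rewrite -orbitE => -[k _ <-]; exists (iterz S k y); first by exists k.
  exact: decoding_iterz.
exists (fun y => nu1 (decode y)), (fun y => nu2 (decode y)); split.
- by move=> y; rewrite decoding_shift nu1P.
- by move=> y; rewrite decoding_iterz [RHS]nu2P.
- exact: one_discontinuity.
- exact: one_discontinuity.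
Qed.
End coded_system.

Local Open Scope ring_scope.

(** * Growth rates and conclusion *)

Lemma superlinear_threshold (R : realType) (p : nat -> R) :
  (forall n : nat, 0 < p n) -> (fun n : nat => n%:R / p n) @ \oo --> (0 : R) ->
  forall c : nat, exists N : nat, forall n, (N <= n)%N -> (c * n)%:R <= p n.
Proof.
move=> p0 lim c; have c0 : 0 < c.+1%:R^-1 :> R by rewrite invr_gt0 ltr0n.
have /cvg_ballP/(_ _ c0)[N _ NP] := lim.
exists N => n /NP; rewrite /ball /= sub0r normrN ger0_norm ?divr_ge0 ?(ltW (p0 n)) //.
rewrite ltr_pdivrMr // mulrC ltr_pdivlMr ?ltr0n // => /ltW H.
by apply: le_trans H; rewrite mulrC -natrM ler_nat leq_mul2r leqnSn orbT.
Qed.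

(** An integer n is controlled through the largest k such that L k <= n, which tends to
infinity with n. *)
Lemma squeeze_complexity (R : realType) (p : nat -> R) (cpl L B : nat -> nat) :
  (forall n : nat, 0 < p n) -> (forall k, (k < L k)%N) ->
  (forall k n, (L k <= n <= L k.+1)%N -> (cpl n <= B k * n)%N) ->
  (forall k n, (L k <= n)%N -> (k.+1 * B k * n)%:R <= p n) ->
  (fun n : nat => (cpl n)%:R / p n) @ \oo --> (0 : R).
Proof.
move=> p0 kL cplB Bp; apply/cvg_ballP => e e0.
have [k0 k0e] : exists k0, k0.+1%:R^-1 < e.
  by have [k0] := ltr_add_invr e0; rewrite add0r => ?; exists k0.
exists (\max_(j < k0.+1) L j)%N => // n /= nL.
rewrite /ball /= sub0r normrN ger0_norm ?divr_ge0 ?(ltW (p0 n)) //.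
have ex : exists k, (L k <= n)%N.
  by exists k0; apply: leq_trans nL; exact: (leq_bigmax (Ordinal (ltnSn k0))).
have bnd k : (L k <= n)%N -> (k <= n)%N by move=> /(leq_trans (kL k))/ltnW.
case: (ex_maxnP ex bnd) => k Lk maxk.
have k0k : (k0 <= k)%N.
  by apply: maxk; apply: leq_trans nL; exact: (leq_bigmax (Ordinal (ltnSn k0))).
have nk : (n <= L k.+1)%N.
  by rewrite leqNgt; apply/negP => /ltnW/maxk; rewrite ltnn.
rewrite ltr_pdivrMr //; apply: le_lt_trans (_ : k.+1%:R^-1 * p n < _).
  rewrite ler_pdivlMl ?ltr0n // -natrM; apply: le_trans (Bp k n Lk).
  by rewrite ler_nat -mulnA leq_mul2l /= cplB // Lk.
rewrite ltr_pM2r //; apply: le_lt_trans k0e.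
by rewrite lef_pV2 ?posrE ?ltr0n // ler_nat.
Qed.

Theorem theorem1p2 (R : realType) (X : metricType R) (T : homeomorphism X X)
    (p : nat -> R) :
  cantor_minimal T ->
  (forall n : nat, 0 < p n) ->
  (fun n : nat => n%:R / p n) @ \oo --> (0 : R) ->
  exists (A : finType) (Y : subshift A),
    [/\ (0 < #|A|)%N,
        minimal_system (subshift_homeo Y),
        strong_orbit_equivalent (subshift_homeo Y) T &
        (fun n : nat => (complexity Y n)%:R / p n) @ \oo --> (0 : R)].
Proof.
move=> [[[x0 _] perfX tdX compX] minT] p0 lim.
have hX : hausdorff_space X by exact: metric_hausdorff.
have [q [lq sepq]] := separating_sequence compX tdX.
have /choice[N NP] := superlinear_threshold p0 lim.
pose B (s : stage X) := (3 * (nletters s * (ntypes s).*2.+1))%N.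
(* larger than k and the blocks of s, and beyond the point where p takes over *)
pose ell k (s : stage X) := (k.+1 + \max_(b < nletters s) len s b + N (k.+1 * B s)%N)%N.
have [s [n2 l1 gs Ds /choice[m refs]]] := stage_sequence compX hX perfX minT lq sepq x0 ell.
pose L k := ell k (s k).
have L0 k : (0 < L k)%N by rewrite /L /ell addSn addSn.
have [Rh [f [nu1 [nu2 [[lf f_inj fR] [nu1P nu2P] near1 near2 cpl]]]]] :=
  reordered_system compX hX sepq l1 gs L0 refs n2.
have cf := continuous_code lf.
exists bool, (coded_subshift compX cf fR); split.
- by rewrite card_bool.
- exact: (coded_minimal minT f_inj nu1P nu2P).
- exact: (coded_strong_orbit_equivalent compX cf f_inj fR nu1P nu2P near1 near2).
- apply: (@squeeze_complexity _ _ _ L (fun k => B (s k))) => //.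
  + by move=> k; rewrite /L /ell -addnA leq_addr.
  + move=> k n /andP[kn nk]; rewrite /B -Ds; apply: cpl => //.
      exact: leq_trans (L0 k) kn.
    move=> b bD; apply: leq_trans kn; rewrite /L /ell.
    apply: leq_trans (leq_addr _ _); apply: leq_trans (leq_addl _ _).
    exact: (leq_bigmax (Ordinal bD)).
  + move=> k n kn; apply: NP; apply: leq_trans kn; exact: leq_addl.
Qed.
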